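(* Let $\Psi\in\mathbb{C}[\mathfrak{n}_l]$ and $C\in\mathbb{C}$. Then the $\mathfrak{so}_{2l}(\mathbb{C})$-module $M_{\mathfrak{n}_l}(C,\Psi)$ is simple if and only if $C\notin-\lfloor l/2\rfloor+\frac12+\frac12\mathbb{Z}_+$. Moreover, if $n\in\mathbb{Z}_+$, $n\le\lfloor l/2\rfloor$ and $C\in-n+\frac12+\frac12\mathbb{Z}_+$, then all proper submodules of $M_{\mathfrak{n}_l}(C,\Psi)$ are generated by some of the elements $P_r^{2r-1+2C}$, $n\le r\le\lfloor l/2\rfloor$.
   Context: $\mathbb{Z}_+=\{1,2,3,\dots\}$ and $a+\frac12\mathbb{Z}_+=\{a+\frac m2\mid m\in\mathbb{Z}_+\}$. A proper submodule is one different from the whole module (the zero submodule being generated by the empty set). Let $l\ge 2$. With $e_{s,t}$ the matrix units of size $2l+1$ and $1\le i,j\le l$, set $X_{i,j}=e_{i+1,j+1}-e_{j+l+1,i+l+1}$, $Y_{i,j}=e_{i+1,j+l+1}-e_{j+1,i+l+1}$, $Z_{i,j}=e_{i+l+1,j+1}-e_{j+l+1,i+1}$; $\mathfrak{so}_{2l}(\mathbb{C})$ is the Lie algebra spanned by all $X_{i,j},Y_{i,j},Z_{i,j}$. Its Chevalley generators are $e_{\alpha_i}=X_{i,i+1}$, $f_{\alpha_i}=X_{i+1,i}$, $h_{\alpha_i}=X_{i,i}-X_{i+1,i+1}$ ($1\le i\le l-1$) and $e_{\alpha'_l}=Y_{l-1,l}$, $f_{\alpha'_l}=Z_{l,l-1}$,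 $h_{\alpha'_l}=X_{l-1,l-1}+X_{l,l}$. The subalgebra $\mathfrak{n}_l=\mathrm{span}_{\mathbb{C}}\{Y_{i,j}\mid 1\le i<j\le l\}$ is abelian and $\mathcal{U}(\mathfrak{n}_l)=\mathbb{C}[\mathfrak{n}_l]$ is the polynomial algebra in the variables $Y_{i,j}$, $i<j$. Since $Y_{j,i}=-Y_{i,j}$ and $Y_{i,i}=0$, the convention is $\frac{\partial}{\partial Y_{j,i}}=-\frac{\partial}{\partial Y_{i,j}}$ and $\frac{\partial}{\partial Y_{i,i}}=0$. For $1\le r\le\lfloor l/2\rfloor$, $P_r\in\mathbb{C}[\mathfrak{n}_l]$ is the Pfaffian of the skew-symmetric $2r\times 2r$ matrix $(Y_{i,j})_{l-2r+1\le i,j\le l}$. Differential operators on $\mathbb{C}[\mathfrak{n}_l]$ (products mean composition): $$\widetilde{X}'_{i,j}=\sum_{r<j}Y_{r,i}\frac{\partial}{\partial Y_{r,j}}+\sum_{s>j}Y_{i,s}\frac{\partial}{\partial Y_{j,s}}\quad(1\le i,j\le l),\qquad \widetilde{Z}'_{l,l-1}=\sum_{k=1}^{l-1}\widetilde{X}'_{k,l-1}\frac{\partial}{\partial Y_{k,l}}.$$ For $C\in\mathbb{C}$, $\Psi\in\mathbb{C}[\mathfrak{n}_l]$ put $x'_{i,j}=\widetilde{X}'_{i,j}(\Psi)+\delta_{i,j}C$ (with $\delta_{i,j}$ the Kronecker delta) and $$z'_{l,l-1}=\Big(\tfrac12\Big(\sum_{k=1}^{l}\widetilde{X}'_{k,l}(\Psi)\tfrac{\partial}{\partial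 Y_{k,l-1}}-\sum_{k=1}^{l}\widetilde{X}'_{k,l-1}(\Psi)\tfrac{\partial}{\partial Y_{k,l}}\Big)-2C\tfrac{\partial}{\partial Y_{l-1,l}}+\widetilde{Z}'_{l,l-1}\Big)(\Psi).$$ $M_{\mathfrak{n}_l}(C,\Psi)$ is the $\mathfrak{so}_{2l}(\mathbb{C})$-module on $\mathbb{C}[\mathfrak{n}_l]$ given, for $f\in\mathbb{C}[\mathfrak{n}_l]$, by $e_{\alpha_i}\cdot f=(x'_{i,i+1}+\widetilde{X}'_{i,i+1})f$, $f_{\alpha_i}\cdot f=(x'_{i+1,i}+\widetilde{X}'_{i+1,i})f$, $h_{\alpha_i}\cdot f=(x'_{i,i}-x'_{i+1,i+1}+\widetilde{X}'_{i,i}-\widetilde{X}'_{i+1,i+1})f$ for $1\le i\le l-1$; $e_{\alpha'_l}\cdot f=Y_{l-1,l}f$, $h_{\alpha'_l}\cdot f=(x'_{l-1,l-1}+x'_{l,l}+\widetilde{X}'_{l-1,l-1}+\widetilde{X}'_{l,l})f$; $f_{\alpha'_l}\cdot f=\Big(z'_{l,l-1}+\sum_{k=1}^{l}\widetilde{X}'_{k,l}(\Psi)\frac{\partial}{\partial Y_{k,l-1}}-\sum_{k=1}^{l}\widetilde{X}'_{k,l-1}(\Psi)\frac{\partial}{\partial Y_{k,l}}-2C\frac{\partial}{\partial Y_{l-1,l}}+\widetilde{Z}'_{l,l-1}\Big)f$. Polynomials appearing as coefficients act by multiplication.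
   Formalization: In the ''Moreover'' part n is taken to be the least positive integer with C in -n+1/2+(1/2)Z_+ (it fails for larger n); since the displayed operators violate [e,f]=h, submodules are the subspaces stable under those operators and their brackets. *)

(* Defs.v *)
From HB Require Import structures.
From mathcomp Require Import all_boot all_order all_algebra all_fingroup.
From mathcomp Require Import reals complex mpoly.

Set Implicit Arguments.
Unset Strict Implicit.
Unset Printing Implicit Defensive.

Import Order.TTheory GRing.Theory Num.Theory.
Local Open Scope ring_scope.

(* Indices are 0-based throughout: the index i in {1, ..., l} is the ordinal
   i - 1 of 'I_l. *)

Section SoMatrices.
Variables (K : fieldType) (l : nat).
Implicit Types i j : 'I_l.

(* The matrix index i + 1, resp. i + l + 1 (i in {1, ..., l}), of a matrix of
   size 2l + 1. *)
Definition upper i : 'I_(1 + (l + l)) := rshift 1 (lshift l i).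
Definition lower i : 'I_(1 + (l + l)) := rshift 1 (rshift l i).

Definition soX i j : 'M[K]_(1 + (l + l)) :=
  delta_mx (upper i) (upper j) - delta_mx (lower j) (lower i).
Definition soY i j : 'M[K]_(1 + (l + l)) :=
  delta_mx (upper i) (lower j) - delta_mx (upper j) (lower i).
Definition soZ i j : 'M[K]_(1 + (l + l)) :=
  delta_mx (lower i) (upper j) - delta_mx (lower j) (upper i).

End SoMatrices.

Definition pairs (l : nat) : finType :=
  {p : 'I_l * 'I_l | (p.1 < p.2)%N}.

(* C[n_l]: one variable for each pair i < j. *)
Notation poly_n K l := {mpoly K[#|pairs l|]}.

Section Pfaffian.
Variables (K : fieldType) (n r : nat).

Lemma even_ord_subproof (i : 'I_r) : (i.*2 < r.*2)%N.
Proof. by rewrite ltn_double. Qed.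

Lemma odd_ord_subproof (i : 'I_r) : (i.*2.+1 < r.*2)%N.
Proof. by rewrite ltn_Sdouble. Qed.

Definition even_ord (i : 'I_r) : 'I_(r.*2) := Ordinal (even_ord_subproof i).
Definition odd_ord (i : 'I_r) : 'I_(r.*2) := Ordinal (odd_ord_subproof i).

(* Meaningful for skew-symmetric A over a field K of characteristic 0. *)
Definition pfaffian (A : 'M[{mpoly K[n]}]_(r.*2)) : {mpoly K[n]} :=
  ((2 ^ r * r`!)%:R)^-1 *:
    \sum_(s : 'S_(r.*2))
      (-1) ^+ s * \prod_(i < r) A (s (even_ord i)) (s (odd_ord i)).

End Pfaffian.

Section Operators.
Variables (K : fieldType) (l : nat).
Implicit Types (i j a b : 'I_l) (f : poly_n K l).

Definition varY i j : poly_n K l :=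
  match insub (i, j) : option (pairs l), insub (j, i) : option (pairs l) with
  | Some p, _ => 'X_(enum_rank p)
  | None, Some p => - 'X_(enum_rank p)
  | None, None => 0
  end.

Definition derY i j f : poly_n K l :=
  match insub (i, j) : option (pairs l), insub (j, i) : option (pairs l) with
  | Some p, _ => f^`M(enum_rank p)
  | None, Some p => - f^`M(enum_rank p)
  | None, None => 0
  end.

Lemma double_ord_half_leq (r : 'I_(l./2).+1) : (r.*2 <= l)%N.
Proof. by rewrite -geq_half_double -ltnS. Qed.

(* Position l - 2r + k in {1, ..., l}, for k in {1, ..., 2r}. *)
Definition corner (r : 'I_(l./2).+1) (k : 'I_(r.*2)) : 'I_l :=
  cast_ord (subnK (double_ord_half_leq r)) (rshift (l - r.*2) k).

Definition pfaffP (r : 'I_(l./2).+1) : poly_n K l :=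
  pfaffian (\matrix_(i < r.*2, j < r.*2) varY (corner i) (corner j)).

Definition opX i j f : poly_n K l :=
  \sum_(r < l | (r < j)%N) varY r i * derY r j f
  + \sum_(s < l | (j < s)%N) varY i s * derY j s f.

(* In the rest of the section a and b stand for l - 1 and l. *)
Definition opZ a b f : poly_n K l :=
  \sum_(k < l | (k < b)%N) opX k a (derY k b f).

Variables (C : K) (Psi : poly_n K l).

Definition cX i j : poly_n K l := opX i j Psi + ((i == j)%:R * C)%:MP.

Definition firstZ a b f : poly_n K l :=
  \sum_(k < l) opX k b Psi * derY k a f
  - \sum_(k < l) opX k a Psi * derY k b f.

Definition cZ a b : poly_n K l :=
  2%:R^-1 *: firstZ a b Psi - (2%:R * C) *: derY a b Psi + opZ a b Psi.

(* [so_acts x T]: the element x of so_2l acts on M(C, Psi) by the operator T.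
   The action is prescribed on the Chevalley generators, which generate the
   Lie algebra so_2l, and extended by linearity and by commutators.  It is
   kept as a relation: with the prescribed sign of [opZ], the operators of
   e_{alpha'_l}, f_{alpha'_l} and h_{alpha'_l} do not satisfy [e, f] = h, so
   no linear map sends the generators to these operators compatibly with
   brackets. *)
Inductive so_acts :
    'M[K]_(1 + (l + l)) -> (poly_n K l -> poly_n K l) -> Prop :=
| so_acts_e i j : j = i.+1 :> nat ->
    so_acts (soX K i j) (fun f => cX i j * f + opX i j f)
| so_acts_f i j : j = i.+1 :> nat ->
    so_acts (soX K j i) (fun f => cX j i * f + opX j i f)
| so_acts_h i j : j = i.+1 :> nat ->
    so_acts (soX K i i - soX K j j)
      (fun f => (cX i i - cX j j) * f + opX i i f - opX j j f)
| so_acts_e' a b : a.+2 = l -> b.+1 = l ->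
    so_acts (soY K a b) (fun f => varY a b * f)
| so_acts_f' a b : a.+2 = l -> b.+1 = l ->
    so_acts (soZ K b a)
      (fun f => cZ a b * f + firstZ a b f - (2%:R * C) *: derY a b f
                + opZ a b f)
| so_acts_h' a b : a.+2 = l -> b.+1 = l ->
    so_acts (soX K a a + soX K b b)
      (fun f => (cX a a + cX b b) * f + opX a a f + opX b b f)
| so_acts_lin c x y T U : so_acts x T -> so_acts y U ->
    so_acts (c *: x + y) (fun f => c *: T f + U f)
| so_acts_bracket x y T U : so_acts x T -> so_acts y U ->
    so_acts (x *m y - y *m x) (fun f => T (U f) - U (T f)).

Definition is_submodule (N : poly_n K l -> Prop) : Prop :=
  [/\ N 0,
      forall (c : K) f g, N f -> N g -> N (c *: f + g)
    & forall x T f, so_acts x T -> N f -> N (T f)].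

Definition proper_submod (N : poly_n K l -> Prop) : Prop := exists f, ~ N f.

Definition simple_module : Prop :=
  (exists f : poly_n K l, f <> 0) /\
  forall N, is_submodule N -> (forall f, N f -> f = 0) \/ (forall f, N f).

(* The submodule generated by S. *)
Definition generated_submod (S : poly_n K l -> Prop) : poly_n K l -> Prop :=
  fun f => forall N, is_submodule N -> (forall g, S g -> N g) -> N f.

(* The elements P_r^(2r - 1 + 2C), r in I; an r for which 2r - 1 + 2C is not a
   natural number contributes nothing. *)
Definition pfaff_powers (I : {set 'I_(l./2).+1}) : poly_n K l -> Prop :=
  fun g => exists r k, [/\ r \in I,
    k%:R = 2%:R * r%:R - 1 + 2%:R * C :> K & g = pfaffP r ^+ k].

End Operators.

(* c is in a + (1/2) Z_+, where Z_+ = {1, 2, 3, ...}. *)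
Definition in_half_lattice (K : fieldType) (a c : K) : Prop :=
  exists2 m : nat, (0 < m)%N & c = a + m%:R / 2%:R.

(* Main.v *)
From HB Require Import structures.
Require Import Defs.
From mathcomp Require Import all_boot all_order all_algebra all_fingroup.
From mathcomp Require Import reals complex mpoly boolp ring zify.

Set Implicit Arguments.
Unset Strict Implicit.
Unset Printing Implicit Defensive.

Import Order.TTheory GRing.Theory Num.Theory.
Local Open Scope ring_scope.

(** Index the variables Y_ij of C[n_l] skew-symmetrically and write d_ij for the
    derivation dual to Y_ij, X_ij = sum_k Y_ik d_jk for the action of gl_l
    by derivations, and D_ij = sum_k X_ki d_kj - 2C d_ij.  Let P_s be the
    Pfaffian of the last 2s rows and columns, k_s = 2s - 1 + 2C, m = l./2.

    The submodules do not depend on Psi.  The iterated commutators of the operators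
    of e_{alpha_i}, f_{alpha_i} with the multiplication by Y_{l-1,l} are
    multiplications by the other Y_ij, so a submodule is an ideal.  All terms
    containing Psi then preserve it, since those of f_{alpha'_l} are combinations
    of X_ij with polynomial coefficients, and what remains of the action says
    that a submodule is an ideal stable under all X_ij and all D_ij
    ([submoduleP]).

    The Fischer product, for which multiplication by Y_ij is adjoint to d_ij and
    X_ij to X_ji, makes the action of gl_l completely reducible.  Hence two
    gl_l-stable subspaces are compared by their highest weight vectors, the
    weight vectors killed by X_ij for i > j ([gl_complement_highest]).  These are,
    up to scalars, the monomials P^a = P_1^a_1 ... P_m^a_m ([highest_class]): if p
    is the least index occurring in such a vector f, then for a suitable q the
    derivative d_pq f is again a highest weight vector, of smaller degree, and
    an evaluation and the dominance of weights force l - p to be even and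
    q = p + 1, and allow to integrate d_pq f back (indices from 0).

    The key computation is, for p, q the first two of the last 2s indices and
    a polynomial g without these two indices,
       D_pq (g P_s^k) = k (k - k_s) g P_s^(k-1) P_(s-1)
    ([opD_pf_corner_exp], [opD_step]).  Thus a submodule containing P^a contains
    the monomial in which the exponents of P_s, for s from m downwards, have been
    moved to P_(s-1), as long as no critical exponent k = k_s is met.  If none is
    met, 1 is reached and the submodule is everything.  Otherwise the descent
    stops at a level u where k_u is a positive integer at most a_u + ... + a_m.
    Multiply by P_u^(k_u): on multiples of P_u^(k_u) by polynomials in the last
    2u indices, D_pq acts as it does for the parameter C - k_u, for which no
    level is critical, so the descent continues to P_u^(k_u) itself
    ([stable_pf_corner_exp]).

    Conversely, an ideal stable under gl_l and containing P_u^k contains all P^a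
    with a_u + ... + a_m >= k ([ideal_pf_mon]): otherwise, by complete
    reducibility, P^a (with only the exponents from u on) would be orthogonal to
    the ideal, and so would its derivatives, among which is a multiple of
    P_u^(a_u + ... + a_m).  So a proper submodule N is generated by the powers
    P_u^(k_u) which it contains, since no submodule containing these can omit a
    highest weight vector of N.  Finally, when k_m is a positive integer, P_m^(k_m)
    is killed by all D_ij and generates a submodule whose elements vanish at
    the origin, so the module is not simple. *)

(** * The differential operators *)

(** Locked, lest unification unfold the operators into the sums that define
    them. *)
HB.lock Definition der (K : fieldType) (l : nat) (i j : 'I_l) (f : poly_n K l) :
  poly_n K l := derY i j f.
HB.lock Definition opx (K : fieldType) (l : nat) (i j : 'I_l) (f : poly_n K l) :
  poly_n K l := opX i j f.

Section Calculus.
Variables (K : fieldType) (l : nat).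
Local Notation P := (poly_n K l).
Implicit Types (i j p q : 'I_l) (f g : P).

Lemma varY_lt i j (h : (i < j)%N) :
  varY K i j = 'X_(enum_rank (Sub (i, j) h : pairs l)).
Proof. by rewrite /varY insubT. Qed.

Lemma varYC i j : varY K j i = - varY K i j.
Proof.
rewrite /varY; case: insubP => [u hu eu|hu]; case: insubP => [v hv ev|hv] //=.
- by have := ltn_trans hu hv; rewrite /= ltnn.
- by rewrite opprK.
- by rewrite oppr0.
Qed.

Lemma varYY i : varY K i i = 0.
Proof. by rewrite /varY; case: insubP => [u /=|]; rewrite ?ltnn. Qed.

Lemma derE i j f : der i j f = derY i j f.
Proof. by rewrite der.unlock. Qed.

Lemma der_lt i j f (h : (i < j)%N) :
  der i j f = f^`M(enum_rank (Sub (i, j) h : pairs l)).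
Proof. by rewrite der.unlock /derY insubT. Qed.

Lemma derC i j f : der j i f = - der i j f.
Proof.
rewrite der.unlock /derY; case: insubP => [u hu eu|hu]; case: insubP => [v hv ev|hv] //=.
- by have := ltn_trans hu hv; rewrite /= ltnn.
- by rewrite opprK.
- by rewrite oppr0.
Qed.

Lemma derii i f : der i i f = 0.
Proof. by rewrite der.unlock /derY; case: insubP => [u /=|]; rewrite ?ltnn. Qed.

Variant pair_spec i j : Prop :=
 | PairLt of (i < j)%N | PairGt of (j < i)%N | PairEq of i = j.

Lemma pairP i j : pair_spec i j.
Proof.
case: (ltngtP i j) => h; [exact: PairLt | exact: PairGt |].
by apply: PairEq; apply: val_inj.
Qed.

Lemma der_is_linear i j : linear (@der K l i j).
Proof.
move=> c f g; case: (pairP i j) => [h|h|<-].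
- by rewrite !der_lt linearP.
- by rewrite !(derC j i) !der_lt linearP opprD scalerN.
- by rewrite !derii scaler0 addr0.
Qed.
HB.instance Definition _ i j :=
  GRing.isLinear.Build K P P _ (@der K l i j) (der_is_linear i j).

Lemma derM i j f g : der i j (f * g) = der i j f * g + f * der i j g.
Proof.
case: (pairP i j) => [h|h|<-].
- by rewrite !der_lt mderivM.
- by rewrite !(derC j i) !der_lt mderivM opprD mulNr mulrN.
- by rewrite !derii mul0r mulr0 addr0.
Qed.

Lemma der_comm i j p q f : der i j (der p q f) = der p q (der i j f).
Proof.
have lt_comm : forall i j p q f, (i < j)%N -> (p < q)%N ->
    der i j (der p q f) = der p q (der i j f).
  by move=> ? ? ? ? ? h1 h2; rewrite !der_lt mderiv_comm.
case: (pairP i j) => [h|h|<-]; last by rewrite !derii linear0.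
  case: (pairP p q) => [h'|h'|<-]; first exact: lt_comm.
    by rewrite !(derC q p) linearN /= lt_comm.
  by rewrite !derii linear0.
case: (pairP p q) => [h'|h'|<-].
- by rewrite !(derC j i) linearN /= lt_comm.
- by rewrite !(derC q p) !(derC j i) !linearN /= lt_comm.
- by rewrite !derii linear0.
Qed.

Lemma der_const i j c : der i j (c%:MP : P) = 0.
Proof.
case: (pairP i j) => [h|h|<-]; last by rewrite derii.
- by rewrite der_lt mderivC.
- by rewrite derC der_lt mderivC oppr0.
Qed.

Lemma der_varY i j p q :
  der i j (varY K p q) = ((i == p) && (j == q))%:R - ((i == q) && (j == p))%:R.
Proof.
have lt_lt : forall i j p q, (i < j)%N -> (p < q)%N ->
    der i j (varY K p q) =
      ((i == p) && (j == q))%:R - ((i == q) && (j == p))%:R.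
  move=> i' j' p' q' h1 h2; rewrite (varY_lt h2) (der_lt _ h1).
  have -> : (i' == q') && (j' == p') = false.
    apply/negP => /andP[/eqP e1 /eqP e2]; move: h1 h2.
    by rewrite e1 e2 => a b; have := ltn_trans a b; rewrite ltnn.
  rewrite subr0 mderivX mnm1E (inj_eq enum_rank_inj) -val_eqE /= xpair_eqE.
  rewrite [q' == _]eq_sym [p' == _]eq_sym.
  case: (boolP (_ && _)) => [/andP[/eqP e1 /eqP e2]|_]; last by rewrite scale0r.
  rewrite scale1r; subst p' q'; rewrite (eq_irrelevance h1 h2).
  suff -> : forall u : 'I_#|pairs l|, (U_(u) - U_(u))%MM = 0%MM :> 'X_{1.. _}.
    by rewrite mpolyX0.
  by move=> u; apply/mnmP => t; rewrite mnmBE mnm0E subnn.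
case: (pairP i j) => [h|h|<-].
- case: (pairP p q) => [h'|h'|<-]; first exact: lt_lt.
    by rewrite varYC linearN /= lt_lt // opprB.
  by rewrite varYY linear0 subrr.
- rewrite derC; case: (pairP p q) => [h'|h'|<-].
  + by rewrite lt_lt // opprB andbC [in X in _ - X]andbC.
  + by rewrite varYC linearN /= lt_lt // !opprK andbC [in X in _ - X]andbC.
  + by rewrite varYY linear0 andbC subrr oppr0.
- by rewrite derii andbC subrr.
Qed.

(** Induction along the skew-symmetric variables rather than the monomials. *)
Lemma varY_ind (Q : P -> Prop) :
  (forall c : K, Q c%:MP) -> (forall f g, Q f -> Q g -> Q (f + g)) ->
  (forall i j f, Q f -> Q (varY K i j * f)) -> forall f, Q f.
Proof.
move=> Qc QD QM.
have QMX : forall m f, Q f -> Q ('X_[m] * f).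
  move=> m f Qf; rewrite mpolyXE_id.
  elim/big_rec: _ => [|k g _ Qg]; first by rewrite mul1r.
  rewrite -mulrA; elim: (m k) => [|n IHn]; first by rewrite expr0 mul1r.
  rewrite exprS -mulrA; case: (enum_val k) (enum_valK k) => -[i j] /= h e.
  by have := QM i j _ IHn; rewrite (varY_lt h) e.
elim/mpolyind => [|c m f _ _ Qf]; first by rewrite -mpolyC0; apply: Qc.
apply: QD => //; rewrite -mul_mpolyC mulrC.
exact: QMX.
Qed.

Lemma sum_delta (R : pzSemiRingType) (i : 'I_l) (F : 'I_l -> R) :
  \sum_m (i == m)%:R * F m = F i.
Proof.
rewrite (bigD1 i) //= eqxx mul1r big1 ?addr0 // => m /negPf ne.
by rewrite eq_sym ne mul0r.
Qed.

(** The two partial sums that define the operator are one sum over all indices,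
    because Y and the derivations are both skew-symmetric. *)
Lemma opxE i j f : opx i j f = \sum_m varY K i m * der j m f.
Proof.
rewrite opx.unlock /opX [RHS](bigID (fun m : 'I_l => (j < m)%N)) /= addrC.
congr (_ + _); last by apply: eq_bigr => m _; rewrite der.unlock.
rewrite [RHS](bigID (fun m : 'I_l => (m < j)%N)) /=.
rewrite [X in _ = _ + X]big1 ?addr0; last first.
  move=> m /= /andP[]; rewrite -!leqNgt => h1 h2.
  have -> : j = m by apply/val_inj/eqP; rewrite eqn_leq h1 h2.
  by rewrite derii mulr0.
apply: eq_big => [m|m h].
  by rewrite andb_idl // -leqNgt => /ltnW.
by rewrite (varYC i m) -derE (derC j m) mulrNN.
Qed.

Lemma opx_is_linear i j : linear (@opx K l i j).
Proof.
move=> c f g; rewrite !opxE scaler_sumr -big_split /=; apply: eq_bigr => m _.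
by rewrite linearP mulrDr scalerAr.
Qed.
HB.instance Definition _ i j :=
  GRing.isLinear.Build K P P _ (@opx K l i j) (opx_is_linear i j).

Lemma opxM i j f g : opx i j (f * g) = opx i j f * g + f * opx i j g.
Proof.
rewrite !opxE mulr_suml mulr_sumr -big_split /=; apply: eq_bigr => m _.
rewrite derM; ring. 
Qed.

Lemma opx_const i j c : opx i j (c%:MP : P) = 0.
Proof. by rewrite opxE big1 // => m _; rewrite der_const mulr0. Qed.

Lemma der1 i j : der i j (1 : P) = 0.
Proof. by rewrite -mpolyC1 der_const. Qed.

Lemma opx1 i j : opx i j (1 : P) = 0.
Proof. by rewrite -mpolyC1 opx_const. Qed.

Lemma der_natl i j n f : der i j (n%:R * f) = n%:R * der i j f.
Proof. by rewrite !mulr_natl raddfMn. Qed.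

Lemma opx_natl i j n f : opx i j (n%:R * f) = n%:R * opx i j f.
Proof. by rewrite !mulr_natl raddfMn. Qed.

Lemma opx_varY i j p q :
  opx i j (varY K p q) = (j == p)%:R * varY K i q + (j == q)%:R * varY K p i.
Proof.
rewrite opxE.
under eq_bigr => m _ do rewrite der_varY -!mulnb !natrM mulrBr.
rewrite sumrB /=.
have -> : \sum_m varY K i m * ((j == p)%:R * (m == q)%:R) = (j == p)%:R * varY K i q.
  under eq_bigr => m _ do rewrite mulrCA [_ * (m == q)%:R]mulrC [m == _]eq_sym.
  by rewrite -mulr_sumr sum_delta.
have -> : \sum_m varY K i m * ((j == q)%:R * (m == p)%:R) = (j == q)%:R * varY K i p.
  under eq_bigr => m _ do rewrite mulrCA [_ * (m == p)%:R]mulrC [m == _]eq_sym.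
  by rewrite -mulr_sumr sum_delta.
by rewrite (varYC i p) mulrN.
Qed.

Lemma opx_der p q i j f :
  opx p q (der i j f) = der i j (opx p q f)
    - ((p == i)%:R * der q j f + (p == j)%:R * der i q f).
Proof.
rewrite [opx p q f]opxE linear_sum /= opxE.
under [in RHS]eq_bigr => m _ do rewrite derM der_varY -!mulnb !natrM mulrBl.
rewrite big_split sumrB /=.
have -> : \sum_m (i == p)%:R * (j == m)%:R * der q m f = (p == i)%:R * der q j f.
  by under eq_bigr => m _ do rewrite -mulrA; rewrite -mulr_sumr sum_delta eq_sym.
have -> : \sum_m (i == m)%:R * (j == p)%:R * der q m f = (p == j)%:R * der q i f.
  by under eq_bigr => m _ do rewrite -mulrA; rewrite sum_delta eq_sym.
rewrite (derC q i) mulrN; under eq_bigr => m _ do rewrite der_comm; ring.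
Qed.

Lemma opx_opx p q i j f :
  opx p q (opx i j f) = opx i j (opx p q f) +
  (q == i)%:R * opx p j f - (p == j)%:R * opx i q f.
Proof.
rewrite [opx i j f]opxE linear_sum /=.
under eq_bigr => m _ do rewrite opxM opx_varY opx_der mulrBr mulrDl mulrDr.
rewrite big_split sumrB !big_split /= -[X in _ + (X - _)]opxE.
have -> : \sum_m (q == i)%:R * varY K p m * der j m f = (q == i)%:R * opx p j f.
  by rewrite opxE mulr_sumr; apply: eq_bigr => m _; rewrite mulrA.
have -> : \sum_m (q == m)%:R * varY K i p * der j m f = varY K i p * der j q f.
  by under eq_bigr => m _ do rewrite -mulrA; rewrite sum_delta.
have -> : \sum_m varY K i m * ((p == j)%:R * der q m f) = (p == j)%:R * opx i q f.
  by rewrite opxE mulr_sumr; apply: eq_bigr => m _; rewrite mulrCA.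
have -> : \sum_m varY K i m * ((p == m)%:R * der j q f) = varY K i p * der j q f.
  by under eq_bigr => m _ do rewrite mulrCA; rewrite sum_delta.
by ring.
Qed.

(** For i, j the last two indices this is the operator of f_{alpha'_l} when
    Psi = 0; commutators with the [opx i j] give the other pairs. *)
Definition opD (C : K) i j f : P :=
  \sum_k opx k i (der k j f) - (2%:R * C) *: der i j f.

Lemma opD_is_linear C i j : linear (opD C i j).
Proof.
move=> c f g; rewrite /opD linearP /=.
under eq_bigr => k _ do rewrite linearP /= linearP /=.
by rewrite big_split /= -scaler_sumr -!mul_mpolyC; ring.
Qed.
HB.instance Definition _ C i j :=
  GRing.isLinear.Build K P P _ (opD C i j) (opD_is_linear C i j).

(** The cross terms which make [opD] fail to be a derivation. *)
Definition opQ i j f g : P := \sum_k opx k i f * der k j g.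

(** Both cross terms of [opD] can therefore be written with the same first
    argument. *)
Lemma opQC i j f g : opQ i j g f = - opQ j i f g.
Proof.
rewrite /opQ; under eq_bigr => k _ do rewrite opxE mulr_suml.
rewrite exchange_big /= -sumrN; apply: eq_bigr => m _.
rewrite opxE mulr_suml -sumrN; apply: eq_bigr => k _.
by rewrite (varYC k m) (derC i m) (derC k j f); ring.
Qed.

Lemma opDM C i j f g :
  opD C i j (f * g) =
  opD C i j f * g + f * opD C i j g + opQ i j f g - opQ j i f g.
Proof.
rewrite -(opQC i j f g) /opD /opQ derM scalerDr.
under eq_bigr => k _ do rewrite derM linearD /= !opxM.
do 3 rewrite big_split /=; rewrite -!mulr_suml -!mulr_sumr mulrBl mulrBr.
rewrite -!mul_mpolyC.
have -> : \sum_i0 der i0 j f * opx i0 i g =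
    \sum_k opx k i g * der k j f.
  by apply: eq_bigr => k _; rewrite mulrC.
by ring.
Qed.

(** The [opD C i j] transform under gl_l like the derivations [der i j]. *)
Lemma opx_opD C p q i j f :
  opx p q (opD C i j f) = opD C i j (opx p q f)
    - ((p == i)%:R * opD C q j f + (p == j)%:R * opD C i q f).
Proof.
rewrite /opD linearB /= linearZ /= linear_sum /= opx_der.
under eq_bigr => k _ do
  rewrite opx_opx opx_der (linearB (opx k i)) (linearD (opx k i)) /= !opx_natl.
rewrite sumrB big_split /= sumrB sum_delta -mulr_sumr.
rewrite [X in _ - X + _ - _]big_split /= -mulr_sumr.
have -> : \sum_k (p == k)%:R * opx k i (der q j f) = opx p i (der q j f).
  by rewrite sum_delta.
by rewrite -!mul_mpolyC; ring.
Qed.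

(** In this form a cross term visibly preserves every gl_l-stable ideal, which
    is what eliminates Psi. *)
Lemma opQE i j f g : opQ i j f g = \sum_m der i m f * opx m j g.
Proof.
rewrite /opQ; under eq_bigr => k _ do rewrite opxE mulr_suml.
rewrite exchange_big /=; apply: eq_bigr => m _.
rewrite opxE mulr_sumr; apply: eq_bigr => k _.
by rewrite (varYC k m) (derC k j); ring.
Qed.

End Calculus.

(** * Submodules as stable ideals *)

Section Stable.
Variables (K : numFieldType) (l : nat).
Local Notation P := (poly_n K l).
Implicit Types (i j p q a b : 'I_l) (f g : P) (N J : P -> Prop).

Definition subspace N := N 0 /\ forall (c : K) f g, N f -> N g -> N (c *: f + g).
Definition gl_stable N := subspace N /\ forall i j f, N f -> N (opx i j f).
Definition ideal N := forall g f, N f -> N (g * f).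
Definition stable C N :=
  [/\ gl_stable N, ideal N & forall i j f, N f -> N (opD C i j f)].

Section Subspace.
Variables (N : P -> Prop) (sN : subspace N).

Lemma subspace0 : N 0. Proof. by case: sN. Qed.
Lemma subspaceD f g : N f -> N g -> N (f + g).
Proof. by move=> nf ng; have := sN.2 1 _ _ nf ng; rewrite scale1r. Qed.
Lemma subspaceZ c f : N f -> N (c *: f).
Proof. by move=> nf; have := sN.2 c _ _ nf subspace0; rewrite addr0. Qed.
Lemma subspaceN f : N f -> N (- f).
Proof. by move=> nf; rewrite -scaleN1r; apply: subspaceZ. Qed.
Lemma subspaceB f g : N f -> N g -> N (f - g).
Proof. by move=> nf /subspaceN ng; apply: subspaceD. Qed.
Lemma subspace_natl n f : N f -> N (n%:R * f).
Proof. by move=> nf; rewrite mulr_natl -scaler_nat; apply: subspaceZ. Qed.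
Lemma subspace_sum (I : Type) (r : seq I) (Q : pred I) (F : I -> P) :
  (forall x, Q x -> N (F x)) -> N (\sum_(x <- r | Q x) F x).
Proof. by move=> h; elim/big_ind: _ => //; [exact: subspace0|exact: subspaceD]. Qed.
Lemma subspace_unscale c f : c != 0 -> N (c *: f) -> N f.
Proof. by move=> c0 /(subspaceZ c^-1); rewrite scalerA mulVf // scale1r. Qed.
End Subspace.

Lemma ideal_gen N : subspace N ->
  (forall i j f, N f -> N (varY K i j * f)) -> ideal N.
Proof.
move=> sN nY g f; elim/varY_ind: g f => [c|g h IHg IHh|i j g IHg] f nf.
- by rewrite mul_mpolyC; apply: subspaceZ.
- by rewrite mulrDl; apply: subspaceD => //; [apply: IHg | apply: IHh].
- by rewrite -mulrA; apply/nY/IHg.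
Qed.

Lemma opX_opx i j f : opX i j f = opx i j f. Proof. by rewrite opx.unlock. Qed.

Variables (C : K) (Psi : P).
Hypothesis l2 : (2 <= l)%N.

Lemma firstZE a b f : firstZ Psi a b f = opQ b a Psi f - opQ a b Psi f.
Proof.
by rewrite /firstZ /opQ; congr (_ - _); apply: eq_bigr => k _;
  rewrite opX_opx derE.
Qed.

Lemma opZE a b f : b.+1 = l -> opZ a b f = \sum_k opx k a (der k b f).
Proof.
move=> bl; rewrite /opZ [RHS](bigID (fun k : 'I_l => (k < b)%N)) /=.
rewrite [X in _ = _ + X]big1 ?addr0.
  by apply: eq_bigr => k _; rewrite opX_opx derE.
move=> k hk; have -> : k = b; last by rewrite derii linear0.
by apply: val_inj => /=; move: hk (ltn_ord k); lia.
Qed.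

Section ToStable.
Variables (N : P -> Prop) (sub : is_submodule C Psi N).

Let sN : subspace N. Proof. by case: sub. Qed.
Let act x T f : so_acts C Psi x T -> N f -> N (T f).
Proof. by case: sub => _ _ h /h; apply. Qed.

Let adj i j := (j == i.+1 :> nat) || (i == j.+1 :> nat).

Let twisted i j f : adj i j -> N f -> N (cX C Psi i j * f + opx i j f).
Proof.
rewrite -opX_opx => /orP[] /eqP e nf.
- exact: (act (so_acts_e C Psi e) nf).
- exact: (act (so_acts_f C Psi e) nf).
Qed.

(** The commutator of a multiplication with a twisted operator does not see the
    twist. *)
Let mul_der i j g : adj i j ->
  (forall f, N f -> N (g * f)) -> forall f, N f -> N (opx i j g * f).
Proof.
move=> ij ng f nf.
have := subspaceB sN (twisted ij (ng _ nf)) (ng _ (twisted ij nf)).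
by rewrite opxM; congr N; ring.
Qed.

Let bl : (l.-1 < l)%N. Proof. by lia. Qed.
Let al : (l.-2 < l)%N. Proof. by lia. Qed.
Let a := Ordinal al.
Let b := Ordinal bl.

(** Lowering the first index from the variable by which e_{alpha'_l} acts. *)
Let mul_varY_b n i : (i + n.+1 = b)%N -> forall f, N f -> N (varY K i b * f).
Proof.
elim: n i => [|n IHn] i e f nf.
  have -> : i = a by apply: val_inj => /=; move: e => /=; lia.
  by apply: (act (@so_acts_e' _ _ C Psi a b _ _) nf) => /=; lia.
have hj : (i.+1 < l)%N by move: e => /=; lia.
have := mul_der (i := i) (j := Ordinal hj) _ (IHn (Ordinal hj) _).
rewrite opx_varY eqxx -val_eqE /= mul1r; case: eqP => [h|_].
  by move: e => /=; lia.
by rewrite mul0r addr0; apply => //=; rewrite ?/adj /= ?eqxx //; move: e => /=; lia.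
Qed.

Let mul_varY_lt n i j : (i < j)%N -> (j + n = b)%N ->
  forall f, N f -> N (varY K i j * f).
Proof.
elim: n i j => [|n IHn] i j ij e f nf.
  have ejb : j = b by apply: val_inj => /=; move: e => /=; lia.
  by rewrite ejb; apply: (mul_varY_b (n := l.-2 - i)) => //=; move: e ij => /=; lia.
have hj : (j.+1 < l)%N by move: e => /=; lia.
have := mul_der (i := j) (j := Ordinal hj) _ (IHn i (Ordinal hj) _ _).
rewrite opx_varY eqxx -val_eqE /= mul1r; case: eqP => [h|_]; first by lia.
by rewrite mul0r add0r; apply => //=; rewrite ?/adj /= ?eqxx //; move: e => /=; lia.
Qed.

Lemma submodule_ideal : ideal N.
Proof.
apply: ideal_gen => // i j f nf; case: (pairP i j) => [h|h|<-].
- by apply: (mul_varY_lt (n := l.-1 - j)) => //=; have := ltn_ord j; lia.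
- rewrite varYC mulNr; apply: subspaceN => //.
  by apply: (mul_varY_lt (n := l.-1 - i)) => //=; have := ltn_ord i; lia.
- by rewrite varYY mul0r; apply: subspace0.
Qed.

Let opx_adj i j f : adj i j -> N f -> N (opx i j f).
Proof.
move=> ij nf; have := subspaceB sN (twisted ij nf) (submodule_ideal (cX C Psi i j) nf).
by rewrite addrC addKr.
Qed.

(** Commutators of the operators with adjacent indices give all the others. *)
Let opx_ne n i j f :
  (i + n.+1 = j)%N \/ (j + n.+1 = i)%N -> N f -> N (opx i j f).
Proof.
elim: n i j f => [|n IHn] i j f e nf.
  by apply: opx_adj => //; rewrite /adj; case: e => e; apply/orP; [left|right]; apply/eqP; lia.
have hm : (minn i j + n.+1 < l)%N by have := ltn_ord i; have := ltn_ord j; lia.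
pose m := Ordinal hm.
have im g : N g -> N (opx i m g).
  case: e => e ng; first by apply: IHn => //=; lia.
  by apply: opx_adj => //; rewrite /adj /=; lia.
have mj g : N g -> N (opx m j g).
  case: e => e ng; last by apply: IHn => //=; lia.
  by apply: opx_adj => //; rewrite /adj /=; lia.
have := subspaceB sN (im _ (mj _ nf)) (mj _ (im _ nf)).
rewrite opx_opx eqxx; have -> : (i == j) = false by apply/eqP => ij; move: e; rewrite ij; lia.
by rewrite mul1r mul0r subr0 addrC addKr.
Qed.

Let opx_neq i j f : i != j -> N f -> N (opx i j f).
Proof.
rewrite -val_eqE /= => ij; apply: (opx_ne (n := (maxn i j - minn i j).-1)); lia.
Qed.

(** The Cartan part gives only differences of the diagonal operators, and
    h_{alpha'_l} the sum of the last two: twice each of them is a combination. *)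
Lemma submodule_opx i j f : N f -> N (opx i j f).
Proof.
move=> nf; have [<-|ij] := eqVneq i j; last exact: opx_neq.
have diff p : N (opx i i f - opx p p f).
  have [->|ip] := eqVneq i p; first by rewrite subrr; apply: subspace0.
  have pi : p != i by rewrite eq_sym.
  have := subspaceB sN (opx_neq ip (opx_neq pi nf)) (opx_neq pi (opx_neq ip nf)).
  by rewrite opx_opx !eqxx !mul1r; congr N; ring.
have : N ((cX C Psi a a + cX C Psi b b) * f + opX a a f + opX b b f).
  by apply: (act (@so_acts_h' _ _ C Psi a b _ _) nf) => /=; lia.
move=> /(fun h => subspaceB sN h (submodule_ideal (cX C Psi a a + cX C Psi b b) nf)).
move=> /(subspaceD sN (subspaceD sN (diff a) (diff b))).
rewrite !opX_opx => h; apply: (subspace_unscale sN (c := 2)); first by rewrite pnatr_eq0.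
by move: h; congr N; rewrite scaler_nat; ring.
Qed.

Let opD_ab f : N f -> N (opD C a b f).
Proof.
move=> nf; have : N (cZ C Psi a b * f + firstZ Psi a b f - (2%:R * C) *: derY a b f
                + opZ a b f).
  by apply: (act (@so_acts_f' _ _ C Psi a b _ _) nf) => /=; lia.
move=> /(fun h => subspaceB sN h (submodule_ideal (cZ C Psi a b) nf)).
have nQ i j : N (opQ i j Psi f).
  rewrite opQE; apply: subspace_sum => // m _; apply: submodule_ideal.
  exact: submodule_opx.
move=> /(fun h => subspaceB sN h (subspaceB sN (nQ b a) (nQ a b))).
rewrite firstZE opZE /opD -?derE //=; last by lia.
by congr N; ring.
Qed.

Let opD_comm i j p q f :
  (forall g, N g -> N (opD C i j g)) -> N f ->
  N ((p == i)%:R * opD C q j f + (p == j)%:R * opD C i q f).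
Proof.
move=> nD nf.
have := subspaceB sN (nD _ (submodule_opx p q nf)) (submodule_opx p q (nD _ nf)).
by rewrite opx_opD; congr N; ring.
Qed.

(** From the last two indices, conjugation by gl_l moves the first index, then
    the second. *)
Lemma submodule_opD i j f : N f -> N (opD C i j f).
Proof.
have ab : (a == b) = false by apply/eqP => /(congr1 val) /=; lia.
have nb p g : N g -> N (opD C p b g).
  move=> ng; have := opD_comm a p opD_ab ng.
  by rewrite eqxx ab mul1r mul0r addr0.
move=> nf; have := opD_comm b j (nb i) nf; rewrite eqxx mul1r => h.
have := subspaceB sN h (subspace_natl sN (b == i) (nb j _ nf)).
by rewrite addrC addKr.
Qed.
End ToStable.

(** Every submodule is an ideal, and modulo an ideal the twist by Psi
    disappears from all the operators. *)
Lemma submoduleP N : is_submodule C Psi N <-> stable C N.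
Proof.
split=> [sub|[[sN nX] nI nD]].
  split; [split | |].
  - by case: sub.
  - exact: submodule_opx sub.
  - exact: submodule_ideal sub.
  - exact: submodule_opD sub.
split; [by case: sN | by case: sN |].
move=> x T f xT; elim: xT f => {x T}
  [i j _|i j _|i j _|a b al bl|a b al bl|a b al bl|c x y T U _ hT _ hU
  |x y T U _ hT _ hU] f nf.
- by rewrite opX_opx; apply: subspaceD => //; [apply: nI|apply: nX].
- by rewrite opX_opx; apply: subspaceD => //; [apply: nI|apply: nX].
- rewrite !opX_opx; apply: subspaceB => //; last exact: nX.
  by apply: subspaceD => //; [apply: nI|apply: nX].
- exact: nI.
- have -> : cZ C Psi a b * f + firstZ Psi a b f - (2%:R * C) *: derY a b f
                + opZ a b f = cZ C Psi a b * f + firstZ Psi a b f + opD C a b f.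
    by rewrite opZE // /opD -derE; ring.
  apply: subspaceD; [by []| |exact: nD].
  apply: subspaceD; [by []|exact: nI|].
  rewrite firstZE !opQE; apply: subspaceB => //.
    by apply: subspace_sum => // m _; apply/nI/nX.
  by apply: subspace_sum => // m _; apply/nI/nX.
- rewrite !opX_opx; apply: subspaceD => //; last exact: nX.
  by apply: subspaceD => //; [apply: nI|apply: nX].
- by apply: (sN.2); [exact: hT|exact: hU].
- by apply: subspaceB => //; [apply/hT/hU|apply/hU/hT].
Qed.
End Stable.

(** * The Fischer product *)

Section Fischer.
Variables (K : numClosedFieldType) (n : nat).
Local Notation P := {mpoly K[n]}.
Implicit Types (f g h : P) (m : 'X_{1..n}) (c : K).

Definition mfact m : nat := (\prod_(i < n) (m i)`!)%N.

(** The Fischer product: distinct monomials are orthogonal, and 'X_[m] has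
    squared norm m!.  It makes multiplication by a variable adjoint to the
    corresponding derivative. *)
Definition fdot f g : K := \sum_(m <- msupp f) (mfact m)%:R * ((f@_m)^* * g@_m).

Lemma fdot_wide (s : seq 'X_{1..n}) f g : uniq s ->
  {subset msupp f <= s} -> fdot f g = \sum_(m <- s) (mfact m)%:R * ((f@_m)^* * g@_m).
Proof.
move=> us sub; rewrite (bigID (mem (msupp f))) /= [X in _ + X]big1 ?addr0.
  rewrite -big_filter; apply: perm_big; apply: uniq_perm; first exact: msupp_uniq.
    exact: filter_uniq.
  by move=> m; rewrite mem_filter andb_idr // => /sub.
by move=> m /memN_msupp_eq0 ->; rewrite rmorph0 mul0r mulr0.
Qed.

Lemma fdotDr f : linear_for *%R (fdot f).
Proof.
move=> c g h; rewrite /fdot mulr_sumr -big_split /=; apply: eq_bigr => m _.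
by rewrite mcoeffD mcoeffZ; ring.
Qed.
HB.instance Definition _ f := GRing.isLinear.Build K P K *%R (fdot f) (fdotDr f).

Lemma fdot_conj f g : (fdot f g)^* = fdot g f.
Proof.
pose s := undup (msupp f ++ msupp g).
have us : uniq s by apply: undup_uniq.
rewrite (@fdot_wide s f g) ?(@fdot_wide s g f) //; last 2 first.
- by move=> m; rewrite mem_undup mem_cat orbC => ->.
- by move=> m; rewrite mem_undup mem_cat => ->.
rewrite rmorph_sum /=; apply: eq_bigr => m _.
by rewrite !rmorphM /= rmorph_nat conjCK; ring.
Qed.

Lemma fdotC f g : fdot f g = 0 -> fdot g f = 0.
Proof. by move=> e; rewrite -fdot_conj e rmorph0. Qed.

Lemma fdotDl f g h : fdot (f + g) h = fdot f h + fdot g h.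
Proof. by rewrite -!(fdot_conj h) linearD rmorphD. Qed.
Lemma fdotZl c f h : fdot (c *: f) h = c^* * fdot f h.
Proof. by rewrite -!(fdot_conj h) linearZ rmorphM. Qed.
Lemma fdotNl f h : fdot (- f) h = - fdot f h.
Proof. by rewrite -!(fdot_conj h) linearN rmorphN. Qed.
Lemma fdot0l h : fdot 0 h = 0.
Proof. by rewrite -(fdot_conj h) linear0 rmorph0. Qed.
Lemma fdot_suml (I : Type) (r : seq I) (Q : pred I) (F : I -> P) h :
  fdot (\sum_(x <- r | Q x) F x) h = \sum_(x <- r | Q x) fdot (F x) h.
Proof.
rewrite -(fdot_conj h) linear_sum rmorph_sum /=; apply: eq_bigr => x _.
by rewrite fdot_conj.
Qed.

Lemma mfact_gt0 m : (0 < mfact m)%N.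
Proof. by rewrite prodn_gt0 // => i; rewrite fact_gt0. Qed.

Lemma fdot_ge0 f : 0 <= fdot f f.
Proof.
by apply: sumr_ge0 => m _; rewrite mulr_ge0 ?ler0n // mulrC mul_conjC_ge0.
Qed.

Lemma fdot_eq0 f : (fdot f f == 0) = (f == 0).
Proof.
apply/idP/eqP => [|->]; last by rewrite linear0.
rewrite /fdot psumr_eq0; last first.
  by move=> m _; rewrite mulr_ge0 ?ler0n // mulrC mul_conjC_ge0.
move=> /allP h; apply/mpolyP => m; rewrite mcoeff0.
have [mf|/memN_msupp_eq0 //] := boolP (m \in msupp f).
have := h m mf; rewrite /= mulf_eq0 pnatr_eq0 -leqn0 leqNgt mfact_gt0 /=.
by rewrite mulrC mul_conjC_eq0 => /eqP.
Qed.

Lemma fdotX m g : fdot 'X_[m] g = (mfact m)%:R * g@_m.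
Proof. by rewrite /fdot msuppX big_seq1 mcoeffX eqxx rmorph1 mul1r. Qed.

Lemma mfactU m i : mfact (m + U_(i)) = ((m i).+1 * mfact m)%N.
Proof.
rewrite /mfact (bigD1 i) //= [in RHS](bigD1 i) //= mnmDE mnm1E eqxx addn1 factS.
rewrite -mulnA; congr (_ * (_ * _))%N; apply: eq_bigr => j ji.
by rewrite mnmDE mnm1E eq_sym (negPf ji) addn0.
Qed.

Lemma fdot_mulX i f g : fdot ('X_i * f) g = fdot f (g^`M(i)).
Proof.
elim/mpolyind: f => [|c m f _ _ IH]; first by rewrite mulr0 !fdot0l.
rewrite mulrDr !fdotDl IH -scalerAr !fdotZl; congr (_ * _ + _).
rewrite -mpolyXD addmC !fdotX mcoeff_mderiv mfactU natrM -mulr_natl.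
ring.
Qed.
End Fischer.

Section FischerY.
Variables (K : numClosedFieldType) (l : nat).
Local Notation P := (poly_n K l).
Implicit Types (f g h : P) (i j p q : 'I_l) (J N : P -> Prop).

Lemma fdot_varY i j f g : fdot (varY K i j * f) g = fdot f (der i j g).
Proof.
case: (pairP i j) => [h|h|<-].
- by rewrite varY_lt der_lt fdot_mulX.
- by rewrite varYC derC varY_lt der_lt mulNr fdotNl linearN fdot_mulX.
- by rewrite varYY derii mul0r fdot0l linear0.
Qed.

Lemma fdot_der i j f g : fdot (der i j f) g = fdot f (varY K i j * g).
Proof. by rewrite -fdot_conj -fdot_varY fdot_conj. Qed.

(** The form is contravariant for gl_l, which gives complete reducibility. *)
Lemma fdot_opx i j f g : fdot (opx i j f) g = fdot f (opx j i g).
Proof.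
rewrite !opxE fdot_suml linear_sum /=; apply: eq_bigr => m _.
by rewrite fdot_varY fdot_der.
Qed.

Definition orth J f := forall g, J g -> fdot g f = 0.

Lemma orth_gl_stable J : gl_stable J -> gl_stable (orth J).
Proof.
move=> [sJ JX]; split; first split.
- by move=> g _; rewrite linear0.
- by move=> c f g hf hg u Ju; rewrite linearP /= hf // hg // mulr0 addr0.
- by move=> i j f hf g Jg; rewrite -fdot_opx; apply/hf/JX.
Qed.

Lemma orth_der J i j f : ideal J -> orth J f -> orth J (der i j f).
Proof. by move=> Ji hf g Jg; rewrite -fdot_varY; apply/hf/Ji. Qed.

Lemma orth_self J f : J f -> orth J f -> f = 0.
Proof. by move=> Jf /(_ f Jf) /eqP; rewrite fdot_eq0 => /eqP. Qed.

(** Orthogonal projection.  Induction on the list of monomials: the elements of J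
    without the first monomial form a subspace of codimension at most 1. *)
Lemma proj_finite (s : seq 'X_{1..#|pairs l|}) J f : subspace J ->
  (forall g, J g -> {subset msupp g <= s}) ->
  exists2 u, J u & orth J (f - u).
Proof.
elim: s J f => [|m s IHs] J f sJ Js.
  exists 0; first exact: subspace0.
  move=> g /Js; case: (eqVneq g 0) => [->|g0 /(_ (mlead g) (mlead_supp g0)) //].
  by rewrite fdot0l.
pose J' g := J g /\ g@_m = 0.
have sJ' : subspace J'.
  split; first by split; [exact: subspace0|rewrite mcoeff0].
  move=> c g h [Jg gm] [Jh hm]; split; first exact: sJ.2.
  by rewrite mcoeffD mcoeffZ gm hm mulr0 addr0.
have J's g : J' g -> {subset msupp g <= s}.
  move=> [Jg gm] t tg; have := Js g Jg t tg; rewrite inE => /orP[/eqP e|//].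
  by move: tg; rewrite mcoeff_msupp e gm eqxx.
have [u [Ju um] uo] := IHs J' f sJ' J's.
have [[g0 [Jg0 g0m]]|nog] := EM (exists g, J g /\ g@_m != 0); last first.
  exists u => // g Jg; apply: uo; split => //; apply: contrapT => /eqP gm.
  by apply: nog; exists g.
have [v [Jv vm] vo] := IHs J' g0 sJ' J's.
have [e [Je em eo]] : exists e, [/\ J e, e@_m != 0 & orth J' e].
  by exists (g0 - v); split => //; [apply: subspaceB|rewrite mcoeffB vm subr0].
have e0 : fdot e e != 0.
  by rewrite fdot_eq0; apply: contraNneq em => ->; rewrite mcoeff0.
pose w := u + (fdot e f / fdot e e) *: e.
exists w; first by apply: subspaceD => //; apply: subspaceZ.
move=> g Jg; pose c := g@_m / e@_m.
have J'g : J' (g - c *: e).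
  split; first by apply: subspaceB => //; apply: subspaceZ.
  by rewrite mcoeffB mcoeffZ divfK // subrr.
have eu : fdot e u = 0 by apply: fdotC; exact: eo.
have -> : g = (g - c *: e) + c *: e by rewrite subrK.
rewrite fdotDl fdotZl /w opprD addrA linearB /= uo // linearZ /=.
have -> : fdot (g - c *: e) e = 0 by apply: eo.
by rewrite mulr0 subrr add0r !linearB /= linearZ /= eu subr0 divfK // subrr mulr0.
Qed.
End FischerY.

(** * Weights and highest weight vectors *)

Section Weights.
Variables (K : numClosedFieldType) (l : nat).
Local Notation P := (poly_n K l).
Local Notation mon := ('X_{1..#|pairs l|}).
Local Notation weight := {ffun 'I_l -> int}.
Implicit Types (f g h : P) (i j p q : 'I_l) (J N : P -> Prop) (m : mon) (w : weight).

Definition var_wt (k : 'I_#|pairs l|) i : nat :=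
  (i == (val (enum_val k)).1) + (i == (val (enum_val k)).2).

Definition mon_wt m : weight := [ffun i => (\sum_k var_wt k i * m k)%N%:Z].

Definition has_weight w f := forall i, opx i i f = (w i)%:~R *: f.

Lemma opx_eigM i f g (a b : K) : opx i i f = a *: f -> opx i i g = b *: g ->
  opx i i (f * g) = (a + b) *: (f * g).
Proof. by move=> ef eg; rewrite opxM ef eg -scalerAl -scalerAr scalerDl. Qed.

Lemma opx_mon i m : opx i i ('X_[m] : P) = (mon_wt m i)%:~R *: 'X_[m].
Proof.
rewrite mpolyXE_id /mon_wt ffunE -pmulrn.
pose R (f : P) (n : nat) := opx i i f = n%:R *: f.
apply: (big_ind2 R) => [|f a g b hf hg|k _].
- by rewrite /R scale0r -[1]mpolyC1 opx_const.
- by rewrite /R natrD; apply: opx_eigM.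
have Rk : R 'X_k (var_wt k i).
  rewrite /R /var_wt; case: (enum_val k) (enum_valK k) => -[p q] /= h <-.
  rewrite -varY_lt opx_varY scaler_nat mulrnDr !mulr_natl.
  by case: (eqVneq i p) => [->|_]; case: (eqVneq _ q) => [<-|_] //=; rewrite ?varYY ?mul0rn.
elim: (m k) => [|n IHn]; first by rewrite muln0 expr0 /R scale0r -[1]mpolyC1 opx_const.
by rewrite exprS mulnS /R natrD; apply: opx_eigM.
Qed.

Lemma mcoeff_opx i f m : (opx i i f)@_m = (mon_wt m i)%:~R * f@_m.
Proof.
elim/mpolyind: f => [|c m' f _ _ IH]; first by rewrite linear0 mcoeff0 mulr0.
rewrite linearP /= opx_mon !mcoeffD !mcoeffZ IH mcoeffX.
by case: eqP => [->|_] /=; ring.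
Qed.

Lemma has_weightP w f :
  has_weight w f <-> forall m, f@_m != 0 -> mon_wt m = w.
Proof.
split=> [h m fm|h i].
  apply/ffunP => i; have /(congr1 (mcoeff m)) := h i.
  rewrite mcoeff_opx mcoeffZ => /(mulIf fm) /eqP; rewrite eqr_int => /eqP //.
apply/mpolyP => m; rewrite mcoeff_opx mcoeffZ.
by have [->|/h ->] := eqVneq (f@_m) 0; rewrite ?mulr0.
Qed.

Lemma has_weight_subspace w : subspace (has_weight w).
Proof.
split=> [i|c f g hf hg i]; first by rewrite linear0 scaler0.
by rewrite linearP /= hf hg scalerDr !scalerA mulrC.
Qed.

Lemma has_weight_ge0 w f i : has_weight w f -> f != 0 -> 0 <= w i.
Proof.
move=> /has_weightP h f0; rewrite -(h (mlead f)) ?mleadc_eq0 //.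
by rewrite /mon_wt ffunE.
Qed.

Lemma has_weight_inj w w' f : f != 0 -> has_weight w f -> has_weight w' f -> w = w'.
Proof.
move=> f0 /has_weightP h /has_weightP h'.
by rewrite -(h (mlead f)) ?mleadc_eq0 // (h' (mlead f)) ?mleadc_eq0.
Qed.

Lemma mon_wt_deg m : (\sum_i mon_wt m i = 2 * (mdeg m)%:Z)%R.
Proof.
under eq_bigr => i _ do rewrite ffunE.
rewrite -(big_morph Posz PoszD (erefl _)) exchange_big /= mdegE.
rewrite -PoszM; congr Posz; rewrite big_distrr /=; apply: eq_bigr => k _.
rewrite -big_distrl /= /var_wt big_split /=; congr (_ * _)%N.
by rewrite -!big_mkcond /= !big_pred1_eq.
Qed.

Definition wt_comp w f : P :=
  \sum_(m <- msupp f | mon_wt m == w) f@_m *: 'X_[m].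

Lemma mcoeff_wt_comp w f m :
  (wt_comp w f)@_m = if mon_wt m == w then f@_m else 0.
Proof.
rewrite /wt_comp raddf_sum /=.
under eq_bigr => m' _ do rewrite mcoeffZ mcoeffX.
have [mf|mf] := boolP (m \in msupp f); last first.
  rewrite big1_seq ?(memN_msupp_eq0 mf); first by case: ifP.
  move=> m' /andP[_ m'f]; case: eqP => [e|_]; last by rewrite mulr0.
  by rewrite -e m'f in mf.
rewrite big_mkcond (bigD1_seq m) ?msupp_uniq //= eqxx mulr1.
rewrite big1 ?addr0 // => m' ne; case: ifP => // _.
by rewrite (negPf ne) mulr0.
Qed.

Lemma has_weight_comp w f : has_weight w (wt_comp w f).
Proof.
apply/has_weightP => m; rewrite mcoeff_wt_comp.
by have [|_] := eqVneq (mon_wt m) w; rewrite ?eqxx.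
Qed.

Lemma wt_comp_sum f :
  f = \sum_(w <- undup [seq mon_wt m | m <- msupp f]) wt_comp w f.
Proof.
apply/mpolyP => m; rewrite raddf_sum /=.
under eq_bigr => w _ do rewrite mcoeff_wt_comp.
have [mf|mf] := boolP (m \in msupp f); last first.
  by rewrite (memN_msupp_eq0 mf) big1 // => w _; case: ifP.
rewrite (bigD1_seq (mon_wt m)) ?undup_uniq ?mem_undup ?map_f //= eqxx.
by rewrite big1 ?addr0 // => w ne; rewrite eq_sym (negPf ne).
Qed.

(** Lagrange interpolation: the factors (X_ii - v_i) / (w_i - v_i) kill the
    components of weight v and fix the one of weight w. *)
Lemma gl_stable_comp J w f : gl_stable J -> J f -> J (wt_comp w f).
Proof.
move=> [sJ JX] Jf.
suff filter_supp (L : seq mon) : exists2 c : mon -> K,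
    (forall m, mon_wt m = w -> c m = 1)
      /\ (forall m, m \in L -> mon_wt m <> w -> c m = 0)
  & exists2 g, J g & forall m, g@_m = c m * f@_m.
  have [c [c1 c0] [g Jg gE]] := filter_supp (msupp f).
  suff -> : wt_comp w f = g by [].
  apply/mpolyP => m; rewrite mcoeff_wt_comp gE; case: eqP => [e|ne].
    by rewrite c1 // mul1r.
  have [mf|/memN_msupp_eq0 ->] := boolP (m \in msupp f); last by rewrite mulr0.
  by rewrite c0 // mul0r.
elim: L => [|m0 L [c [c1 c0] [g Jg gE]]].
  by exists (fun=> 1); [split|exists f => // m; rewrite mul1r].
have [e|ne] := eqVneq (mon_wt m0) w.
  exists c; last by exists g.
  split=> // m; rewrite inE => /orP[/eqP ->|/c0 //]; by rewrite e.
have [i ni] : exists i, mon_wt m0 i != w i.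
  apply/existsP; apply: contraNT ne => /existsPn h.
  by apply/eqP/ffunP => i; apply/eqP; have := h i; rewrite negbK.
pose a : K := (w i)%:~R - (mon_wt m0 i)%:~R.
have a0 : a != 0 by rewrite subr_eq0 eqr_int eq_sym.
exists (fun m => a^-1 * ((mon_wt m i)%:~R - (mon_wt m0 i)%:~R) * c m).
  split=> m; first by move=> e; rewrite e c1 // mulr1 mulVf.
  rewrite inE => /orP[/eqP ->|mL ne']; first by rewrite subrr mulr0 mul0r.
  by rewrite c0 // mulr0.
exists (a^-1 *: (opx i i g - (mon_wt m0 i)%:~R *: g)).
  by apply: subspaceZ => //; apply: subspaceB => //; [apply: JX|apply: subspaceZ].
by move=> m; rewrite mcoeffZ mcoeffB mcoeff_opx mcoeffZ gE; ring.
Qed.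

(** Only finitely many monomials have a given weight, so the projection exists
    in one weight space; it is orthogonal to all of J because J contains the
    weight components of its elements. *)
Lemma proj_weight J w f : gl_stable J -> has_weight w f ->
  exists u, [/\ J u, has_weight w u & orth J (f - u)].
Proof.
move=> gJ fw; pose Jw g := J g /\ has_weight w g.
pose d := (absz (\sum_i w i)).+1.
pose s := [seq bmnm t | t <- enum {: 'X_{1..#|pairs l| < d}}].
have [sw [sJ JX]] := (has_weight_subspace w, gJ).
have [||u [Ju uw] uo] := @proj_finite K l s Jw f.
- split; first by split; [exact: subspace0|exact: subspace0].
  by move=> c g h [Jg gw] [Jh hw]; split; [exact: sJ.2|exact: sw.2].
- move=> g [Jg /has_weightP gw] m; rewrite mcoeff_msupp => gm.
  have md : (mdeg m < d)%N.
    by have := mon_wt_deg m; rewrite (gw m gm) /d; lia.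
  by apply/mapP; exists (BMultinom md); rewrite ?mem_enum.
exists u; split=> // g Jg.
have := uo (wt_comp w g) (conj (gl_stable_comp w gJ Jg) (has_weight_comp w g)).
have /has_weightP vw : has_weight w (f - u) by apply: (subspaceB sw).
move=> /fdotC h; apply: fdotC; rewrite -h; apply: eq_bigr => m.
by rewrite mcoeff_wt_comp => _; have [->|/vw ->] := eqVneq ((f - u)@_m) 0;
  rewrite ?eqxx // rmorph0 !mul0r.
Qed.

(** Highest for the Borel subalgebra of the [opx i j] with j <= i, which is the
    one for which the Pfaffians of the last rows are highest. *)
Definition highest f := forall i j, (j < i)%N -> opx i j f = 0.

Lemma highest_subspace : subspace highest.
Proof.
split=> [i j _|c f g hf hg i j ij]; first by rewrite linear0.
by rewrite linearP /= hf // hg // scaler0 addr0.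
Qed.

Lemma highestM f g : highest f -> highest g -> highest (f * g).
Proof. by move=> hf hg i j ij; rewrite opxM hf // hg // mul0r mulr0 addr0. Qed.

Lemma has_weight_opx w f i j : has_weight w f ->
  has_weight [ffun k => w k + (k == i)%:Z - (k == j)%:Z] (opx i j f).
Proof.
move=> fw k; rewrite opx_opx fw linearZ /= ffunE intrB intrD -!pmulrn.
rewrite !mulr_natl -!scaler_nat scalerBl scalerDl.
by congr (_ + _ - _); case: eqVneq => [->|_] //; rewrite !scale0r.
Qed.

Lemma has_weight_der w f p q : has_weight w f ->
  has_weight [ffun k => w k - (k == p)%:Z - (k == q)%:Z] (der p q f).
Proof.
move=> fw k; rewrite opx_der fw linearZ /= ffunE !intrB -!pmulrn.
rewrite !mulr_natl -!scaler_nat !scalerBl opprD addrA.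
by congr (_ - _ - _); case: eqVneq => [->|_] //; rewrite !scale0r.
Qed.

(** The norm of [opx p q f] is (w q - w p) times that of f. *)
Lemma highest_dominant w f p q : (p < q)%N ->
  highest f -> has_weight w f -> f != 0 -> w p <= w q.
Proof.
move=> pq hf fw f0.
have ff : 0 < fdot f f by rewrite lt_def fdot_eq0 f0 fdot_ge0.
have := fdot_ge0 (opx p q f).
rewrite fdot_opx opx_opx hf // linear0 add0r !eqxx !mul1r !fw -scalerBl.
by rewrite linearZ /= pmulr_lge0 // subr_ge0 ler_int.
Qed.

(** Raising operators decrease the weighted degree [phi], which is nonnegative
    on nonzero vectors. *)
Lemma exists_highest J f : gl_stable J -> J f -> f != 0 ->
  exists g w, [/\ J g, g != 0, has_weight w g & highest g].
Proof.
move=> gJ Jf f0; have [sJ JX] := gJ.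
pose phi w : int := \sum_(i < l) (l%:Z - (i : nat)%:Z) * w i.
have phi_ge0 w g : g != 0 -> has_weight w g -> 0 <= phi w.
  move=> g0 gw; apply: sumr_ge0 => i _; apply: mulr_ge0.
    by have := ltn_ord i; lia.
  exact: has_weight_ge0 gw g0.
suff H n w g : phi w < n%:Z -> J g -> g != 0 -> has_weight w g ->
    exists g w, [/\ J g, g != 0, has_weight w g & highest g].
  pose w := mon_wt (mlead f).
  apply: (H `|phi w|%N.+1 w (wt_comp w f)).
  - by lia.
  - exact: gl_stable_comp.
  - apply/eqP => /(congr1 (mcoeff (mlead f))).
    by rewrite mcoeff_wt_comp eqxx mcoeff0 => /eqP; rewrite mleadc_eq0 (negPf f0).
  - exact: has_weight_comp.
elim: n w g => [|n IHn] w g lt_n Jg g0 gw.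
  by have := phi_ge0 w g g0 gw; lia.
have [hg|] := EM (highest g); first by exists g, w.
move=> /existsNP [i /existsNP [j /not_implyP [ij /eqP Xg0]]].
apply: (IHn _ _ _ (JX i j g Jg) Xg0 (has_weight_opx i j gw)).
suff -> : phi [ffun k => w k + (k == i)%:Z - (k == j)%:Z] = phi w + j%:Z - i%:Z.
  by lia.
have phi1 a : \sum_(k < l) (l%:Z - (k : nat)%:Z) * (k == a)%:Z = l%:Z - (a : nat)%:Z.
  rewrite (bigD1 a) //= eqxx mulr1 big1 ?addr0 // => k /negPf ->.
  by rewrite mulr0.
rewrite /phi; under eq_bigr => k _ do rewrite ffunE mulrBr mulrDr.
by rewrite sumrB big_split /= !phi1; ring.
Qed.

(** Complete reducibility in the form used to compare stable subspaces: the
    orthogonal complement of N and J inside N is stable, hence contains a highest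
    weight vector. *)
Lemma gl_complement_highest N J : gl_stable N -> gl_stable J ->
  ~ (forall f, N f -> J f) ->
  exists g w, [/\ N g, ~ J g, has_weight w g & highest g].
Proof.
move=> gN gJ; have [[sN NX] [sJ JX]] := (gN, gJ).
move=> /existsNP [f /not_implyP [Nf nJf]].
have [w nJw] : exists w, ~ J (wt_comp w f).
  apply: contrapT => /forallNP h; apply: nJf; rewrite (wt_comp_sum f).
  by apply: subspace_sum => // w _; apply: contrapT; apply: h.
pose I g := N g /\ J g.
have gI : gl_stable I.
  split; last by move=> i j g [Ng Jg]; split; [apply: NX|apply: JX].
  split; first by split; exact: subspace0.
  by move=> c g h [? ?] [? ?]; split; [apply: sN.2|apply: sJ.2].
have [u [[Nu Ju] uw uo]] := proj_weight gI (has_weight_comp w f).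
set v := _ - u in uo.
have Nv : N v by apply: subspaceB => //; apply: gl_stable_comp.
have v0 : v != 0.
  by apply: contra_notN nJw; rewrite subr_eq0 => /eqP ->.
have [gO OX] := orth_gl_stable gI.
have gV : gl_stable (fun g => N g /\ orth I g).
  split; last by move=> i j g [Ng Jg]; split; [apply: NX|apply: OX].
  split; first by split; exact: subspace0.
  by move=> c g h [? ?] [? ?]; split; [apply: sN.2|apply: gO.2].
have [g [w' [[Ng Og] g0 gw hg]]] := exists_highest gV (conj Nv uo) v0.
exists g, w'; split=> // Jg.
by move/eqP: g0; apply; apply: (orth_self (J := I)).
Qed.
End Weights.

(** * Derivatives of a Pfaffian *)

Lemma derivation_prod (R : comNzRingType) (T : R -> R) (I : eqType) (r : seq I) (F : I -> R) :
  T 1 = 0 -> (forall f g, T (f * g) = T f * g + f * T g) -> uniq r ->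
  T (\prod_(t <- r) F t) =
  \sum_(t <- r) T (F t) * \prod_(t' <- r | t' != t) F t'.
Proof.
move=> T1 TM; elim: r => [|a r IHr] /=; first by rewrite !big_nil.
move=> /andP[ar ur]; rewrite !big_cons TM IHr // eqxx /=; congr (_ * _ + _).
  rewrite big_seq_cond [RHS]big_seq_cond; apply: eq_bigl => t.
  rewrite andbT; by case: (boolP (t \in r)) => //= tr; apply/esym; apply: contraNneq ar => <-.
rewrite mulr_sumr [LHS]big_seq [RHS]big_seq; apply: eq_bigr => t tr.
rewrite big_cons ifT; first by rewrite mulrCA.
by apply: contraNneq ar => ->.
Qed.

Lemma sum_lift_perm (R : nmodType) n (i j : 'I_n.+1) (Q : pred 'S_n.+1) (G : 'S_n.+1 -> R) :
  \sum_(s : 'S_n.+1 | (s i == j) && Q s) G s =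
  \sum_(s | Q (lift_perm i j s)) G (lift_perm i j s).
Proof.
have surj (s : 'S_n.+1) : s i = j -> exists s', lift_perm i j s' = s.
  move=> si; pose f k := odflt k (unlift j (s (lift i k))).
  have fE k : lift j (f k) = s (lift i k).
    rewrite /f; case: unliftP => [k' //|e]; move: e; rewrite -[RHS]si.
    by move/perm_inj/eqP; rewrite eq_sym (negPf (neq_lift _ _)).
  have f_inj : injective f.
    by move=> k k' /(congr1 (lift j)); rewrite !fE => /perm_inj/lift_inj.
  exists (perm f_inj); apply/permP => k; case: (unliftP i k) => [k'|] ->.
    by rewrite lift_perm_lift permE fE.
  by rewrite lift_perm_id si.
have L_inj : injective (@lift_perm n i j).
  move=> s s' e; apply/permP => k; apply: (@lift_inj _ j).
  by rewrite -!(lift_perm_lift i) e.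
pose g (s : 'S_n.+1) := odflt 1%g [pick s' | lift_perm i j s' == s].
have gK s' : g (lift_perm i j s') = s'.
  rewrite /g; case: pickP => [t /eqP /L_inj //|/(_ s')]; by rewrite eqxx.
rewrite (reindex (lift_perm i j)) /=.
  by apply: eq_bigl => s; rewrite lift_perm_id eqxx.
exists g => [s _|s /andP[/eqP si _]]; first exact: gK.
by have [s' <-] := surj s si; rewrite gK.
Qed.

Lemma val_tperm n (x y z : 'I_n) : val (tperm x y z) =
  if val z == val x then val y else if val z == val y then val x else val z.
Proof.
rewrite !val_eqE; case: tpermP => [->|->|/eqP/negPf -> /eqP/negPf -> //].
  by rewrite eqxx.
by rewrite eqxx; case: eqP => [->|].
Qed.

Section PfaffianCalculus.
Variables (K : numFieldType) (l : nat).
Local Notation P := (poly_n K l).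

Definition pf_factor r (c : 'I_(r.*2) -> 'I_l) (s : 'I_(r.*2) -> 'I_(r.*2))
  (t : 'I_r) : P := varY K (c (s (even_ord t))) (c (s (odd_ord t))).

Section Fixed.
Variables (r : nat) (c : 'I_(r.*2) -> 'I_l).
Hypothesis c_inj : injective c.

Definition pf_on (c : 'I_(r.*2) -> 'I_l) : P :=
  pfaffian (\matrix_(i < r.*2, j < r.*2) varY K (c i) (c j)).

Local Notation F := (pf_factor c).

Lemma pf_onE : pf_on c =
  (2 ^ r * r`!)%:R^-1 *: \sum_(s : 'S_(r.*2)) (-1) ^+ s * \prod_t F s t.
Proof.
rewrite /pf_on /pfaffian; congr (_ *: _); apply: eq_bigr => s _; congr (_ * _).
by apply: eq_bigr => t _; rewrite mxE.
Qed.

Lemma der_sign i j (b : bool) (f : P) : der i j ((-1) ^+ b * f) = (-1) ^+ b * der i j f.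
Proof. by rewrite !mulr_sign; case: b; rewrite ?linearN. Qed.
Lemma opx_sign i j (b : bool) (f : P) : opx i j ((-1) ^+ b * f) = (-1) ^+ b * opx i j f.
Proof. by rewrite !mulr_sign; case: b; rewrite ?linearN. Qed.

Lemma der_prod i j (s : 'I_(r.*2) -> 'I_(r.*2)) :
  der i j (\prod_t F s t) =
  \sum_t der i j (F s t) * \prod_(t' | t' != t) F s t'.
Proof.
apply: derivation_prod; [exact: der1|exact: derM|exact: index_enum_uniq].
Qed.

Lemma opx_prod i j (s : 'I_(r.*2) -> 'I_(r.*2)) :
  opx i j (\prod_t F s t) =
  \sum_t opx i j (F s t) * \prod_(t' | t' != t) F s t'.
Proof.
apply: derivation_prod; [exact: opx1|exact: opxM|exact: index_enum_uniq].
Qed.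

Lemma der_pf_outside i j : (forall k, c k != i) -> der i j (pf_on c) = 0.
Proof.
move=> ci; rewrite pf_onE linearZ linear_sum /= big1 ?scaler0 // => s _.
rewrite der_sign der_prod big1 ?mulr0 // => t _.
by rewrite der_varY ![i == _]eq_sym !(negPf (ci _)) subr0 mul0r.
Qed.

Let move_idx (i j x : 'I_(r.*2)) := if x == j then i else x.

(** A permutation takes the value j exactly once, so the derivation replaces
    a single index j by i. *)
Lemma opx_prod_perm i j (s : 'S_(r.*2)) :
  opx (c i) (c j) (\prod_t F s t) = \prod_t F (move_idx i j \o s) t.
Proof.
pose u := (s^-1)%g j.
have t0P : (u./2 < r)%N by have := ltn_ord u; lia.
pose t0 := Ordinal t0P.
have su : s u = j by rewrite /u permKV.
have cs k : (c j == c (s k)) = (u == k).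
  by rewrite (inj_eq c_inj) -su (inj_eq perm_inj).
have tE t : (u == even_ord t) || (u == odd_ord t) = (t == t0).
  rewrite -!val_eqE /=; lia.
have xE k : move_idx i j (s k) = if u == k then i else s k.
  by rewrite /move_idx -su (inj_eq perm_inj) eq_sym.
rewrite opx_prod (bigD1 t0) //= [X in _ + X]big1 ?addr0.
  rewrite [RHS](bigD1 t0) //=; congr (_ * _).
    rewrite /pf_factor opx_varY !cs /= !xE.
    have : (u == even_ord t0) (+) (u == odd_ord t0).
      by rewrite -!val_eqE /=; lia.
    by case: (_ == even_ord _); case: (_ == odd_ord _) => //= _;
      rewrite mul1r mul0r ?addr0 ?add0r.
  apply: eq_bigr => t; rewrite -tE negb_or /pf_factor /= !xE => /andP[/negPf -> /negPf ->].
  by [].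
move=> t; rewrite -tE negb_or => /andP[/negPf h1 /negPf h2].
by rewrite /pf_factor opx_varY !cs h1 h2 !mul0r addr0 mul0r.
Qed.

(** When i and j differ, replacing j by i creates a repeated row: composing with
    the transposition of i and j then pairs off opposite terms. *)
Lemma opx_pf i j : opx (c i) (c j) (pf_on c) = (i == j)%:R * pf_on c.
Proof.
rewrite pf_onE linearZ linear_sum /=.
under eq_bigr => s _ do rewrite opx_sign opx_prod_perm.
have [<-|ij] := eqVneq i j.
  rewrite mul1r; congr (_ *: _); apply: eq_bigr => s _; congr (_ * _).
  by apply: eq_bigr => t _; rewrite /pf_factor /= /move_idx; do 2!case: eqP => [->|_].
set S := \sum_s _; suff -> : S = 0 by rewrite scaler0 mul0r.
have SN : S = - S.
  rewrite {1}/S (reindex_inj (mulIg (tperm i j))) /= -sumrN; apply: eq_bigr => s _.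
  rewrite odd_permM odd_tperm ij addbT signrN mulNr; congr (- (_ * _)).
  apply: eq_bigr => t _; rewrite /pf_factor /= !permM.
  have mt x : move_idx i j (tperm i j x) = move_idx i j x.
    by rewrite /move_idx; case: tpermP => [->|->|//]; rewrite eqxx ?if_same.
  by rewrite !mt.
have /eqP : S *+ 2 = 0 by rewrite mulr2n {2}SN subrr.
by rewrite -scaler_nat scaler_eq0 pnatr_eq0 => /eqP.
Qed.
End Fixed.

Section TopDerivative.
Variables (r : nat) (c : 'I_(r.+1.*2) -> 'I_l).
Hypothesis c_inj : injective c.

Local Notation F := (pf_factor c).
Let e0 : 'I_(r.+1.*2) := even_ord (ord0 : 'I_r.+1).
Let e1 : 'I_(r.+1.*2) := odd_ord (ord0 : 'I_r.+1).
Let B t (s : 'S_(r.+1.*2)) : P :=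
  (-1) ^+ s * (der (c e0) (c e1) (F s t) * \prod_(t' | t' != t) F s t').

(** All the blocks of a perfect matching contribute equally: the permutation
    exchanging the blocks t and 0 is even. *)
Let sum_B t : \sum_s B t s = \sum_s B ord0 s.
Proof.
pose tau := (tperm (even_ord t) e0 * tperm (odd_ord t) e1)%g.
have tau_even t' : tau (even_ord t') = even_ord (tperm t ord0 t').
  by apply: val_inj; rewrite permM /= !val_tperm /=; do !case: eqP => /=; lia.
have tau_odd t' : tau (odd_ord t') = odd_ord (tperm t ord0 t').
  by apply: val_inj; rewrite permM /= !val_tperm /=; do !case: eqP => /=; lia.
have tau_sign : odd_perm tau = false.
  by rewrite odd_permM !odd_tperm -!val_eqE /= eqSS addbb.
clearbody tau; rewrite (reindex_inj (mulgI tau)) /=; apply: eq_bigr => s _.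
have FE t' : F (tau * s)%g t' = F s (tperm t ord0 t').
  by rewrite /pf_factor !permM tau_even tau_odd.
rewrite /B odd_permM tau_sign addFb FE tpermL; congr (_ * (_ * _)).
rewrite (reindex_inj (@perm_inj _ (tperm t ord0))) /=.
apply: eq_big => [t'|t' _]; last by rewrite FE tpermK.
by rewrite (can2_eq (tpermK _ _) (tpermK _ _)) tpermL.
Qed.

(** Likewise for the two orders inside the first block, where the sign of the
    transposition compensates that of the variable. *)
Let sum_B0 : \sum_s B ord0 s =
  2%:R * \sum_(s : 'S_(r.+1.*2) | (s e0 == e0) && (s e1 == e1))
     (-1) ^+ s * \prod_(t' | t' != ord0) F s t'.
Proof.
have BE s : B ord0 s =
    (if (s e0 == e0) && (s e1 == e1) then
      (-1) ^+ s * \prod_(t' | t' != ord0) F s t' else 0)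
    - (if (s e1 == e0) && (s e0 == e1) then
      (-1) ^+ s * \prod_(t' | t' != ord0) F s t' else 0).
  rewrite /B /pf_factor der_varY !(inj_eq c_inj) mulrBl mulrBr.
  rewrite [e0 == s e0]eq_sym [e0 == s e1]eq_sym [e1 == s e1]eq_sym [e1 == s e0]eq_sym.
  by congr (_ - _); case: ifP => _; rewrite ?mul1r // mul0r mulr0.
under eq_bigr => s _ do rewrite BE.
rewrite sumrB /= -!big_mkcond /= [X in _ - X](reindex_inj (mulgI (tperm e0 e1))) /=.
rewrite mulr_natl mulr2n; congr (_ + _); rewrite -sumrN.
have ne : e0 != e1 by rewrite -val_eqE.
apply: eq_big => [s|s _]; first by rewrite !permM tpermL tpermR.
rewrite odd_permM odd_tperm ne /= signrN mulNr opprK; congr (_ * _).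
apply: eq_bigr => t; rewrite -val_eqE /= => t0.
by rewrite /pf_factor !permM !tpermD // -val_eqE /=; lia.
Qed.

(** The coefficient of the first variable in the expansion of a Pfaffian along
    its first row. *)
Lemma der_pf_top : der (c e0) (c e1) (pf_on c) =
  pf_on (fun k : 'I_(r.*2) => c (lift ord0 (lift ord0 k))).
Proof.
rewrite !pf_onE linearZ linear_sum /=.
under eq_bigr => s _ do rewrite der_sign der_prod mulr_sumr.
rewrite exchange_big /=.
under eq_bigr => t _ do rewrite -/(B t _) sum_B.
rewrite sumr_const card_ord sum_B0.
have -> : \sum_(s : 'S_(r.+1.*2) | (s e0 == e0) && (s e1 == e1))
     (-1) ^+ s * \prod_(t' | t' != ord0) F s t' =
  \sum_(s : 'S_(r.*2)) (-1) ^+ s * \prod_t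
    varY K (c (lift ord0 (lift ord0 (s (even_ord t)))))
           (c (lift ord0 (lift ord0 (s (odd_ord t))))).
  have -> : e0 = ord0 by apply: val_inj.
  have -> : e1 = lift ord0 ord0 by apply: val_inj.
  rewrite sum_lift_perm.
  under eq_bigl => s do rewrite lift_perm_lift (inj_eq lift_inj) -[_ == _]andbT.
  rewrite sum_lift_perm; apply: eq_bigr => s _; rewrite !odd_lift_perm /=.
  congr (_ * _); rewrite big_mkcond big_ord_recl /= mul1r; apply: eq_bigr => t _.
  rewrite /pf_factor; congr (varY K (c _) (c _)).
    have -> : even_ord (lift ord0 t) = lift ord0 (lift ord0 (even_ord t)).
      by apply: val_inj; rewrite /= /bump /=; lia.
    by rewrite !lift_perm_lift.
  have -> : odd_ord (lift ord0 t) = lift ord0 (lift ord0 (odd_ord t)).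
    by apply: val_inj; rewrite /= /bump /=; lia.
  by rewrite !lift_perm_lift.
rewrite mulr_natl -mulrnA -scaler_nat scalerA; congr (_ *: _).
rewrite expnS factS !natrM.
have hr : (r.+1%:R : K) != 0 by rewrite pnatr_eq0.
have h2r : ((2 ^ r)%:R : K) != 0 by rewrite pnatr_eq0 expn_eq0.
have hf : (r`!%:R : K) != 0 by rewrite pnatr_eq0 -lt0n fact_gt0.
by field; rewrite hf h2r addrC natr1 hr.
Qed.
End TopDerivative.
End PfaffianCalculus.

(** * Monomials in the corner Pfaffians *)

Section Corner.
Variables (K : numClosedFieldType) (l : nat).
Local Notation P := (poly_n K l).
Implicit Types (f g h : P) (i j p q : 'I_l) (s t : nat) (a : nat -> nat).

(** Meaningful for [s <= l./2], the range in which [inord s] is [s]. *)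
Definition pf_corner s : P := pfaffP K (inord s : 'I_(l./2).+1).
Definition in_corner s i := (l - s.*2 <= i)%N.

Lemma pfaffP_pf_on r (c : 'I_(r.*2) -> 'I_l) (r0 : 'I_(l./2).+1) :
  r0 = r :> nat -> (forall k, c k = l - r.*2 + k :> nat)%N ->
  pfaffP K r0 = pf_on K c.
Proof.
move=> e; subst r => cE; rewrite /pfaffP /pf_on; congr pfaffian.
by apply/matrixP => x y; rewrite !mxE; congr (varY K _ _);
  apply: val_inj; rewrite /= cE.
Qed.

Lemma pf_cornerE s : (s <= l./2)%N -> exists c : 'I_(s.*2) -> 'I_l,
  [/\ (forall k, c k = l - s.*2 + k :> nat)%N, injective c & pf_corner s = pf_on K c].
Proof.
move=> sl; have cP (k : 'I_(s.*2)) : (l - s.*2 + k < l)%N by have := ltn_ord k; lia.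
exists (fun k => Ordinal (cP k)); split => //.
  by move=> x y /(congr1 val) /= /addnI /val_inj.
by apply: pfaffP_pf_on => //; rewrite inordK.
Qed.

Lemma in_cornerP s i (c : 'I_(s.*2) -> 'I_l) : (s <= l./2)%N ->
  (forall k, c k = l - s.*2 + k :> nat)%N -> in_corner s i -> exists k, i = c k.
Proof.
move=> sl cE si.
have kP : (i - (l - s.*2) < s.*2)%N by have := ltn_ord i; move: si; rewrite /in_corner; lia.
exists (Ordinal kP); apply: val_inj; rewrite /= cE /=; move: si; rewrite /in_corner; lia.
Qed.

Lemma opx_pf_corner s i j : (s <= l./2)%N -> in_corner s i -> in_corner s j ->
  opx i j (pf_corner s) = (i == j)%:R * pf_corner s.
Proof.
move=> sl; have [c [cE c_inj ->]] := pf_cornerE sl.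
move=> /(in_cornerP sl cE) [x ->] /(in_cornerP sl cE) [y ->].
by rewrite opx_pf // (inj_eq c_inj).
Qed.

Lemma der_pf_corner_out s i j : (s <= l./2)%N -> ~~ in_corner s i -> der i j (pf_corner s) = 0.
Proof.
move=> sl; have [c [cE c_inj ->]] := pf_cornerE sl => si.
apply: der_pf_outside => k; apply: contraNneq si => <-.
by rewrite /in_corner cE leq_addr.
Qed.

Lemma der_pf_corner_top s p q : (s.+1 <= l./2)%N ->
  p = (l - s.+1.*2)%N :> nat -> q = p.+1 :> nat -> der p q (pf_corner s.+1) = pf_corner s.
Proof.
move=> sl pE qE; have [c [cE c_inj ->]] := pf_cornerE sl.
have -> : p = c (even_ord (ord0 : 'I_s.+1)) by apply: val_inj; rewrite /= cE /= pE; lia.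
have -> : q = c (odd_ord (ord0 : 'I_s.+1)) by apply: val_inj; rewrite /= cE /= qE pE; lia.
rewrite der_pf_top //; apply/esym/pfaffP_pf_on; first by rewrite inordK //; lia.
by move=> k; rewrite cE /= /bump /=; lia.
Qed.

Lemma pf_corner0 : pf_corner 0 = 1.
Proof.
have [c [_ _ ->]] := pf_cornerE (leq0n _); rewrite pf_onE.
rewrite (big_pred1 1%g); last first.
  by move=> s; apply/esym/eqP/permP => -[].
by rewrite odd_perm1 expr0 mul1r big_ord0 expn0 fact0 invr1 scale1r.
Qed.

Lemma opx_out i j f : (forall m, der j m f = 0) -> opx i j f = 0.
Proof. by move=> h; rewrite opxE big1 // => m _; rewrite h mulr0. Qed.

(** The point of n_l at which Y_ij is 1 for consecutive indices i, i + 1 with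
    l - i even (indices from 0) and 0 for the other pairs i < j. All the corner
    Pfaffians take the value 1 there, so it serves to see that they and
    their monomials do not vanish. *)
Definition sympl (k : 'I_#|pairs l|) : K :=
  let: (p, q) := val (enum_val k) in (~~ odd (l - p) && (q == p.+1 :> nat))%:R.

Lemma sympl_varY i j : (varY K i j).@[sympl] =
  (~~ odd (l - i) && (j == i.+1 :> nat))%:R - (~~ odd (l - j) && (i == j.+1 :> nat))%:R.
Proof.
have lt i' j' (h : (i' < j')%N) : (varY K i' j').@[sympl] =
    (~~ odd (l - i') && (j' == i'.+1 :> nat))%:R.
  by rewrite (varY_lt K h) mevalXU /sympl enum_rankK.
case: (pairP i j) => [h|h|<-].
- by rewrite lt // (_ : (i == j.+1 :> nat) = false) ?andbF ?subr0 //; lia.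
- by rewrite varYC mevalN lt // (_ : (j == i.+1 :> nat) = false) ?andbF ?sub0r //; lia.
- by rewrite varYY meval0 subrr.
Qed.

(** Euler's identity for the first row of the Pfaffian, of which a single
    term survives at this point. *)
Lemma sympl_pf_corner s : (s <= l./2)%N -> (pf_corner s).@[sympl] = 1.
Proof.
elim: s => [|s IHs] sl; first by rewrite pf_corner0 meval1.
have pP : (l - s.+1.*2 < l)%N by lia.
have qP : ((l - s.+1.*2).+1 < l)%N by lia.
pose p := Ordinal pP; pose q := Ordinal qP.
have := @opx_pf_corner _ p p sl (leqnn _) (leqnn _); rewrite eqxx mul1r => <-.
rewrite opxE raddf_sum /= (bigD1 q) //= big1 ?addr0; last first.
  move=> m mq; rewrite mevalM sympl_varY.
  have -> : (m == p.+1 :> nat) = false.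
    by apply: contraNF mq => /eqP e; apply/eqP/val_inj.
  rewrite andbF (_ : ~~ odd _ && _ = false) ?subrr ?mul0r //.
  apply/negP => /andP[o /eqP e]; move: o e => /=; lia.
rewrite mevalM der_pf_corner_top // IHs ?mulr1; last by lia.
rewrite sympl_varY /= eqxx andbT.
have -> : ~~ odd (l - (l - s.+1.*2)) by lia.
by rewrite (_ : (_ == _.+2) = false) ?andbF ?subr0 //; lia.
Qed.

Definition pf_mon t a : P := \prod_(1 <= s < t.+1) pf_corner s ^+ a s.

Lemma pf_monS t a : pf_mon t.+1 a = pf_mon t a * pf_corner t.+1 ^+ a t.+1.
Proof. by rewrite /pf_mon big_nat_recr. Qed.
Lemma pf_mon0 a : pf_mon 0 a = 1.
Proof. by rewrite /pf_mon big_geq. Qed.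

Lemma eq_pf_mon t a b : (forall s, (0 < s <= t)%N -> a s = b s) -> pf_mon t a = pf_mon t b.
Proof. by move=> e; apply: eq_big_nat => s h; rewrite e. Qed.

Lemma pf_mon_widen t u a : (u <= t)%N -> (forall s, (u < s <= t)%N -> a s = 0%N) ->
  pf_mon t a = pf_mon u a.
Proof.
elim: t => [|t IHt]; first by case: u.
rewrite leq_eqVlt => /orP[/eqP -> //|ut] h.
rewrite pf_monS h ?ut ?leqnn // expr0 mulr1 IHt // => s hs.
by apply: h; lia.
Qed.

Lemma pf_monD t a b : pf_mon t (fun s => a s + b s)%N = pf_mon t a * pf_mon t b.
Proof.
by rewrite /pf_mon -big_split; apply: eq_bigr => s _; rewrite exprD.
Qed.

Lemma sympl_pf_mon t a : (t <= l./2)%N -> (pf_mon t a).@[sympl] = 1.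
Proof.
elim: t => [|t IHt] tl; first by rewrite pf_mon0 meval1.
by rewrite pf_monS mevalM rmorphXn /= IHt 1?ltnW // sympl_pf_corner // expr1n mulr1.
Qed.

Lemma pf_mon_neq0 t a : (t <= l./2)%N -> pf_mon t a != 0.
Proof.
move=> tl; apply/eqP => e; have := sympl_pf_mon a tl.
by rewrite e meval0 => /eqP; rewrite eq_sym oner_eq0.
Qed.

Lemma der_exp0 i j f n : der i j f = 0 -> der i j (f ^+ n) = 0.
Proof.
move=> h; elim: n => [|n IHn]; first by rewrite expr0 der1.
by rewrite exprS derM h IHn mul0r mulr0 addr0.
Qed.

Lemma derXn i j f n : der i j (f ^+ n.+1) = n.+1%:R * (f ^+ n * der i j f).
Proof.
elim: n => [|n IHn]; first by rewrite expr1 expr0 !mul1r.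
by rewrite exprS derM IHn exprS -[n.+2%:R]natr1; move: (f ^+ n) (n.+1%:R : P) => F c; ring.
Qed.

Lemma opxXn i j f n : opx i j (f ^+ n.+1) = n.+1%:R * (f ^+ n * opx i j f).
Proof.
elim: n => [|n IHn]; first by rewrite expr1 expr0 !mul1r.
by rewrite exprS opxM IHn exprS -[n.+2%:R]natr1; move: (f ^+ n) (n.+1%:R : P) => F c; ring.
Qed.

Lemma der_pf_mon_out t a i j : (t <= l./2)%N -> ~~ in_corner t i -> der i j (pf_mon t a) = 0.
Proof.
elim: t => [|t IHt] tl ti; first by rewrite pf_mon0 der1.
rewrite pf_monS derM IHt ?mul0r ?add0r 1?ltnW //; last first.
  by move: ti; rewrite /in_corner; lia.
by rewrite der_exp0 ?mulr0 // der_pf_corner_out.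
Qed.

(** For j < i, either j does not occur in the Pfaffian, or i also occurs and
    replacing j by i makes two rows equal. *)
Lemma highest_pf_corner s : (s <= l./2)%N -> highest (pf_corner s).
Proof.
move=> sl i j ji; have [sj|sj] := boolP (in_corner s j).
  rewrite opx_pf_corner //; last by move: sj; rewrite /in_corner; lia.
  by rewrite (_ : (i == j) = false) ?mul0r //; apply/eqP => e; move: ji; rewrite e ltnn.
by apply: opx_out => m; apply: der_pf_corner_out.
Qed.

Lemma weight_pf_corner s : (s <= l./2)%N ->
  has_weight [ffun i => (in_corner s i)%:Z] (pf_corner s).
Proof.
move=> sl i; rewrite ffunE; have [si|si] := boolP (in_corner s i).
  by rewrite opx_pf_corner // eqxx mul1r scale1r.
by rewrite scale0r opx_out // => m; apply: der_pf_corner_out.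
Qed.

Definition pf_mon_wt t a : {ffun 'I_l -> int} :=
  [ffun i => (\sum_(1 <= s < t.+1) in_corner s i * a s)%N%:Z].

Lemma highest1 : highest (1 : P).
Proof. by move=> i j _; rewrite opx1. Qed.

Lemma highest_pf_mon t a : (t <= l./2)%N -> highest (pf_mon t a).
Proof.
elim: t => [|t IHt] tl; first by rewrite pf_mon0; apply: highest1.
rewrite pf_monS; apply: highestM; first by apply: IHt; apply: ltnW.
elim: (a _) => [|n IHn]; first by rewrite expr0; apply: highest1.
by rewrite exprS; apply: highestM => //; apply: highest_pf_corner.
Qed.

Lemma weight_pf_mon t a : (t <= l./2)%N -> has_weight (pf_mon_wt t a) (pf_mon t a).
Proof.
elim: t => [|t IHt] tl i.
  by rewrite pf_mon0 opx1 /pf_mon_wt ffunE big_geq // scale0r.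
rewrite pf_monS ffunE big_nat_recr //= PoszD intrD; apply: opx_eigM.
  by rewrite IHt 1?ltnW // ffunE.
elim: (a _) => [|n IHn]; first by rewrite expr0 opx1 muln0 scale0r.
rewrite exprS mulnS PoszD intrD; apply: opx_eigM => //.
by rewrite weight_pf_corner // ffunE.
Qed.

Lemma der_pf_mon_top t a p q : (t.+1 <= l./2)%N ->
  p = (l - t.+1.*2)%N :> nat -> q = p.+1 :> nat ->
  der p q (pf_mon t.+1 a) =
    (a t.+1)%:R * (pf_mon t a * (pf_corner t.+1 ^+ (a t.+1).-1 * pf_corner t)).
Proof.
move=> tl pE qE; rewrite pf_monS derM der_pf_mon_out 1?ltnW //; last first.
  by rewrite /in_corner pE; lia.
rewrite mul0r add0r; case: (a _) => [|n]; first by rewrite expr0 der1 mulr0 mul0r.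
by rewrite derXn der_pf_corner_top //=; ring.
Qed.
End Corner.

(** * Classification of the highest weight vectors *)

Section Classification.
Variables (K : numClosedFieldType) (l : nat).
Local Notation P := (poly_n K l).
Local Notation weight := {ffun 'I_l -> int}.
Implicit Types (f g h : P) (i j p q : 'I_l) (s t : nat) (a : nat -> nat) (w : weight).

Lemma der_all0 f : (forall i j, der i j f = 0) -> f = (f@_0%MM)%:MP.
Proof.
move=> h; have /has_weightP fw : has_weight [ffun=> 0] f.
  by move=> i; rewrite ffunE scale0r opx_out.
apply/mpolyP => m; rewrite mcoeffC.
have [->|m0] := eqVneq m 0%MM; first by rewrite mulr1.
rewrite mulr0; apply/eqP; apply: contraNT m0 => /fw e.
have := mon_wt_deg m; rewrite e -mdeg_eq0.
under eq_bigr => i _ do rewrite ffunE.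
by rewrite sumr_const mul0rn; lia.
Qed.

Definition wsum w : int := \sum_i w i.

(** The induction hypothesis of the classification, on the degree. *)
Definition classified n := forall g w,
  wsum w < n%:Z -> g != 0 -> has_weight w g -> highest g ->
  exists a c, c != 0 /\ g = c *: pf_mon K l l./2 a.

Lemma wsum_der w p q :
  wsum [ffun k => w k - (k == p)%:Z - (k == q)%:Z] = wsum w - 2.
Proof.
have w1 r : \sum_(k < l) (k == r)%:Z = 1 :> int.
  by rewrite (bigD1 r) //= eqxx big1 ?addr0 // => k /negPf ->.
rewrite /wsum; under eq_bigr => k _ do rewrite ffunE.
by rewrite !sumrB !w1; ring.
Qed.

(** Take p least among the indices occurring in f, then q least with
    d_pq f nonzero.  The commutators of [opx i j], j < i, with d_pq only produce
    derivatives that vanish by minimality, so d_pq f is highest and the induction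
    hypothesis applies.  If l - p is odd, the relation X_ip f = 0, evaluated at
    [sympl] with i the partner of q, says that d_pq f vanishes there, while a
    monomial in the Pfaffians does not.  If l - p is even, d_pq f has equal weights
    at p and p + 1, and dominance for f leaves only q = p + 1. *)
Lemma top_derivative n f w : classified n ->
  wsum w < n.+1%:Z -> has_weight w f -> highest f ->
  (exists i j, der i j f != 0) ->
  exists p q a c,
    [/\ forall k j : 'I_l, (k < p)%N -> der k j f = 0,
        ~~ odd (l - p), q = p.+1 :> nat,
        c != 0 & der p q f = c *: pf_mon K l l./2 a].
Proof.
move=> cl wn fw hf [i0 [j0 ij0]].
have P0 : [exists j, der i0 j f != 0] by apply/existsP; exists j0.
case: (@arg_minnP _ i0 (fun i => [exists j, der i j f != 0]) (fun i : 'I_l => i : nat) P0)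
  => p /existsP [q0 pq0] pmin.
case: (@arg_minnP _ q0 (fun j => der p j f != 0) (fun j : 'I_l => j : nat) pq0)
  => q pq qmin {q0 pq0 i0 j0 ij0 P0}.
have lt_p (k j : 'I_l) : (k < p)%N -> der k j f = 0.
  move=> kp; apply/eqP; apply: contraTT kp => kj; rewrite -leqNgt.
  by apply: pmin; apply/existsP; exists j.
have lt_q (j : 'I_l) : (j < q)%N -> der p j f = 0.
  by move=> jq; apply/eqP; apply: contraTT jq => pj; rewrite -leqNgt; apply: qmin.
have pltq : (p < q)%N.
  rewrite ltnNge; apply: contraNN pq; rewrite leq_eqVlt => /orP[/eqP/val_inj ->|qp].
    by rewrite derii.
  by rewrite derC lt_p // oppr0.
set g := der p q f in pq.
have gw := has_weight_der p q fw; rewrite -/g in gw.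
have hg : highest g.
  move=> i j ji; rewrite /g opx_der hf // linear0 sub0r.
  have [ip|_] := eqVneq i p; have [iq|_] := eqVneq i q;
    rewrite ?mul0r ?mul1r ?add0r ?addr0 ?oppr0 //.
  - by move: pltq; rewrite -ip -iq ltnn.
  - by rewrite lt_p ?oppr0 // -ip.
  - by rewrite lt_q ?oppr0 // -iq.
have [|a [c [c0 gE]]] := cl g _ _ pq gw hg; first by rewrite wsum_der; lia.
have ev_g : g.@[sympl K (l:=l)] = c.
  by rewrite gE mevalZ sympl_pf_mon // mulr1.
have even_p : ~~ odd (l - p).
  apply/negP => lp.
  (* the index paired with q at the symplectic point *)
  have [i iE] : exists i : 'I_l,
      odd (l - q) /\ i.+1 = q :> nat \/ ~~ odd (l - q) /\ i = q.+1 :> nat.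
    have [lq|lq] := boolP (odd (l - q)).
      have il : (q.-1 < l)%N by have := ltn_ord q; lia.
      by exists (Ordinal il); left => /=; split; lia.
    have il : (q.+1 < l)%N by have := ltn_ord q; lia.
    by exists (Ordinal il); right.
  have pi : (p < i)%N by lia.
  have := congr1 (meval (sympl K (l:=l))) (hf i p pi).
  rewrite opxE raddf_sum /= meval0 (bigD1 q) //= big1 ?addr0; last first.
    move=> m mq; rewrite mevalM sympl_varY /=.
    have {}mq : (m != q :> nat) by [].
    have ml := ltn_ord m.
    have -> : ~~ odd (l - i) && (m == i.+1 :> nat) = false by lia.
    have -> : ~~ odd (l - m) && (i == m.+1 :> nat) = false by lia.
    by rewrite subrr mul0r.
  rewrite mevalM ev_g => /eqP; rewrite mulf_eq0 (negPf c0) orbF sympl_varY.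
  have ql := ltn_ord q.
  case: iE => -[lq iE].
    have -> : ~~ odd (l - i) && (q == i.+1 :> nat) = true by lia.
    have -> : ~~ odd (l - q) && (i == q.+1 :> nat) = false by lia.
    by rewrite subr0 oner_eq0.
  have -> : ~~ odd (l - i) && (q == i.+1 :> nat) = false by lia.
  have -> : ~~ odd (l - q) && (i == q.+1 :> nat) = true by lia.
  by rewrite sub0r oppr_eq0 oner_eq0.
exists p, q, a, c; split=> //.
have p1l : (p.+1 < l)%N by have := ltn_ord p; lia.
pose p1 := Ordinal p1l.
have f0 : f != 0 by apply: contraNneq pq => f0; rewrite /g f0 linear0.
have := @highest_dominant _ _ w f p p1 (ltnSn _) hf fw f0.
have gww := has_weight_inj pq gw.
have gpm : has_weight (pf_mon_wt l l./2 a) g.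
  by rewrite gE; apply: (subspaceZ (has_weight_subspace _ _)); apply: weight_pf_mon.
have e := gww _ gpm.
have ep := congr1 (fun u : weight => u p) e; have ep1 := congr1 (fun u : weight => u p1) e.
move: ep ep1; rewrite /= !ffunE eqxx.
have -> : (p1 == p) = false by rewrite -val_eqE /=; lia.
have -> : (p == q) = false by rewrite -val_eqE /=; lia.
have -> : (\sum_(1 <= s < l./2.+1) in_corner s p1 * a s)%N =
    (\sum_(1 <= s < l./2.+1) in_corner s p * a s)%N.
  apply: eq_big_nat => s hs; congr ((_ : bool) * _)%N; rewrite /in_corner /=; lia.
have [/(congr1 val) /= <- //|_] := eqVneq p1 q.
by lia.
Qed.

(** Dominance shows that the derivative of f is divisible by the Pfaffian of the
    next smaller corner, hence is the derivative of a monomial f'.  The difference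
    of f and a multiple of f' is highest of the same weight with a vanishing top
    derivative, and the previous lemma leaves only 0. *)
Lemma highest_class f w : f != 0 -> has_weight w f -> highest f ->
  exists a c, c != 0 /\ f = c *: pf_mon K l l./2 a.
Proof.
suff H n : classified n by apply: (H `|wsum w|%N.+1); lia.
elim: n {f w} => [|n IHn] f w wn f0 fw hf.
  have : 0 <= wsum w by apply: sumr_ge0 => i _; apply: has_weight_ge0 fw f0.
  by lia.
have [[i [j ij]]|nd] := EM (exists i j, der i j f != 0); last first.
  have e := der_all0 (f := f).
  have {}e : f = (f@_0%MM)%:MP.
    by apply: e => i j; apply: contrapT => /eqP ij; apply: nd; exists i, j.
  exists (fun=> 0%N), f@_0%MM; split.
    by apply: contraNneq f0 => e0; rewrite e e0 mpolyC0.
  rewrite {1}e (pf_mon_widen K l (u := 0)) // pf_mon0 -mul_mpolyC mulr1 //.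
have [|p [q [a [c [lt_p lp qE c0 gE]]]]] := top_derivative IHn wn fw hf; first by exists i, j.
pose s0 := (l - p)./2.
have [u uE] : exists u, s0 = u.+1 by exists s0.-1; rewrite /s0; have := ltn_ord q; lia.
have ul : (u.+1 <= l./2)%N by rewrite -uE /s0; lia.
have pE : p = (l - u.+1.*2)%N :> nat by rewrite -uE /s0; have := ltn_ord p; lia.
have g0 : der p q f != 0 by rewrite gE scaler_eq0 negb_or c0 pf_mon_neq0.
have gw := has_weight_der p q fw.
have gpm : has_weight (pf_mon_wt l l./2 a) (der p q f).
  by rewrite gE; apply: (subspaceZ (has_weight_subspace _ _)); apply: weight_pf_mon.
have we := has_weight_inj g0 gw gpm.
have pq : (p == q) = false by rewrite -val_eqE /=; lia.
have a_gt s : (u.+1 < s <= l./2)%N -> a s = 0%N.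
  move=> hs; have kl : (l - s.*2 < l)%N by lia.
  pose k := Ordinal kl.
  have : opx k k (der p q f) = 0.
    apply: opx_out => m; rewrite der_comm lt_p ?linear0 //=; lia.
  rewrite gpm => /eqP; rewrite scaler_eq0 (negPf g0) orbF intr_eq0 ffunE eqz_nat.
  rewrite sum_nat_seq_eq0 => /allP /(_ s); rewrite mem_index_iota.
  by rewrite /in_corner leqnn mul1n => h; apply/eqP/h; lia.
have ga : pf_mon K l l./2 a = pf_mon K l u.+1 a by rewrite (pf_mon_widen K l ul).
have a_u : (0 < u)%N -> (0 < a u)%N.
  move=> u0; have p2l : (q.+1 < l)%N by rewrite qE pE; lia.
  pose r := Ordinal p2l.
  have := @highest_dominant _ _ w f q r (ltnSn _) hf fw f0.
  have := congr1 (fun v : weight => v q) we; have := congr1 (fun v : weight => v r) we.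
  rewrite /= !ffunE eqxx [q == p]eq_sym pq.
  have -> : (r == p) = false by rewrite -val_eqE /=; lia.
  have -> : (r == q) = false by rewrite -val_eqE /=; lia.
  have -> : (\sum_(1 <= s < l./2.+1) in_corner s r * a s)%N =
      ((\sum_(1 <= s < l./2.+1) in_corner s q * a s) + a u)%N.
    have -> : a u = (\sum_(1 <= s < l./2.+1) (s == u) * a s)%N.
      rewrite (bigD1_seq u) ?iota_uniq ?mem_index_iota //=; last by lia.
      by rewrite eqxx mul1n big1 ?addn0 // => s /negPf ->.
    rewrite -big_split /=; apply: eq_big_nat => s hs; rewrite -mulnDl; congr (_ * _)%N.
    by rewrite /in_corner /=; move: (ltn_ord q); rewrite qE pE; case: eqP; lia.
  by lia.
(* the monomial whose derivative is the one found: one factor of level u is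
   exchanged for one of level u + 1 *)
pose a' s := if s == u.+1 then (a s).+1 else if s == u then (a s).-1 else a s.
pose f' := pf_mon K l u.+1 a'.
have f'D : der p q f' = (a u.+1).+1%:R *: pf_mon K l u.+1 a.
  rewrite /f' der_pf_mon_top // /a' eqxx /= pf_monS scaler_nat mulr_natl; congr (_ *+ _).
  rewrite mulrCA [RHS]mulrC; congr (_ * _).
  case: (u) a_u => [_|v /(_ isT) av]; first by rewrite pf_corner0 !pf_mon0 mul1r.
  rewrite !pf_monS (_ : (v.+1 == v.+2) = false) ?eqxx; last by lia.
  rewrite -mulrA -exprSr prednK //; congr (_ * _).
  by apply: eq_pf_mon => s hs; case: eqP; [lia|case: eqP => //; lia].
have f'w0 : has_weight (pf_mon_wt l u.+1 a') f' by apply: weight_pf_mon.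
have f'g0 : der p q f' != 0.
  by rewrite f'D scaler_eq0 negb_or pnatr_eq0 pf_mon_neq0.
have f'w : has_weight w f'.
  suff -> : w = pf_mon_wt l u.+1 a' by [].
  have h1 := has_weight_der p q f'w0.
  have h2 : has_weight (pf_mon_wt l l./2 a) (der p q f').
    by rewrite f'D -ga; apply: (subspaceZ (has_weight_subspace _ _)); apply: weight_pf_mon.
  have := has_weight_inj f'g0 h1 h2; rewrite -we => /ffunP h.
  by apply/ffunP => i'; have := h i'; rewrite !ffunE => /addIr /addIr.
pose k := c / (a u.+1).+1%:R.
have k0 : k != 0 by rewrite mulf_neq0 // invr_eq0 pnatr_eq0.
exists a', k; split=> //.
rewrite (pf_mon_widen K l (u := u.+1)) //; last first.
  move=> s /andP[us sl]; rewrite /a' !gtn_eqF ?us ?(ltn_trans _ us) //.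
  by apply: a_gt; rewrite us.
apply/eqP; rewrite -subr_eq0; apply: contraT; set f2 := f - _ => f20.
have sw := @has_weight_subspace K l w; have sh := highest_subspace K l.
have f2w : has_weight w f2 by apply: (subspaceB sw) => //; apply: (subspaceZ sw).
have hf2 : highest f2.
  by apply: (subspaceB sh) => //; apply: (subspaceZ sh); apply: highest_pf_mon.
have lt_p2 (m j' : 'I_l) : (m < p)%N -> der m j' f2 = 0.
  move=> mp; rewrite linearB linearZ /= lt_p // der_pf_mon_out //.
    by rewrite scaler0 subrr.
  by rewrite /in_corner -pE -ltnNge.
have pq2 : der p q f2 = 0.
  rewrite linearB linearZ /= gE ga -/f' f'D scalerA /k divfK ?subrr // pnatr_eq0 //.
have [m pm] : exists m, der p m f2 != 0.
  apply: contrapT => /forallNP h; have : opx p p f2 = 0.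
    by apply: opx_out => m; apply: contrapT => /eqP; apply: h.
  rewrite f2w => /eqP; rewrite scaler_eq0 (negPf f20) orbF intr_eq0.
  have := congr1 (fun v : weight => v p) we; rewrite /= !ffunE eqxx pq.
  by move=> + /eqP wp; rewrite wp.
have [|p2 [q2 [a2 [c2 [lt_p2' _ q2E c20 g2E]]]]] := top_derivative IHn wn f2w hf2.
  by exists p, m.
have g20 : der p2 q2 f2 != 0 by rewrite g2E scaler_eq0 negb_or c20 pf_mon_neq0.
have pp2 : p2 = p.
  apply: val_inj; apply/eqP; rewrite eqn_leq; apply/andP; split.
    by rewrite leqNgt; apply: contraNN pm => /lt_p2' ->.
  by rewrite leqNgt; apply: contraNN g20 => /lt_p2 ->.
have qq2 : q2 = q by apply: val_inj; rewrite /= q2E pp2 qE.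
by move: g20; rewrite pp2 qq2 pq2 eqxx.
Qed.
End Classification.

(** * Descent from one Pfaffian to the previous one *)

Section Descent.
Variables (K : numClosedFieldType) (l : nat).
Local Notation P := (poly_n K l).
Local Notation pf_corner := (pf_corner K l).
Local Notation pf_mon := (pf_mon K l).
Implicit Types (f g h : P) (i j p q : 'I_l) (s t r : nat) (a : nat -> nat)
  (C : K) (N J : P -> Prop).

(** The exponent at which the powers of [pf_corner s] are killed by [opD C]. *)
Definition crit_exp C s : K := 2 * s%:R - 1 + 2 * C.

Lemma sum_geq_nat n m : (\sum_(j < n) (m <= j) = n - m)%N.
Proof.
elim: n => [|n IHn]; first by rewrite big_ord0.
by rewrite big_ord_recr /= IHn; case: leqP; lia.
Qed.

(** The eigenvalue: differentiating the exponent twice gives n, and the 2s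
    commutators of [opx j p] with [der j q] give 2 - 2s. *)
Lemma opD_pf_corner_exp C s p q n : (s <= l./2)%N -> in_corner s p -> in_corner s q ->
  opD C p q (pf_corner s ^+ n.+1) =
  (n.+1%:R * (n.+1%:R - crit_exp C s)) *: (pf_corner s ^+ n * der p q (pf_corner s)).
Proof.
move=> sl sp sq; set A := pf_corner s; set B := der p q A.
have X0 j : in_corner s j -> opx j p (A ^+ n) = (j == p)%:R * (n%:R * A ^+ n).
  case: n => [|n] sj; first by rewrite expr0 opx1 mul0r mulr0.
  by rewrite opxXn opx_pf_corner // exprSr; ring.
have term j : opx j p (der j q (A ^+ n.+1)) =
   n.+1%:R * ((j == p)%:R * (n%:R * (A ^+ n * B))
     + (in_corner s j)%:R * (((j == p)%:R + (j == q)%:R - 1) * (A ^+ n * B))).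
  rewrite derXn opx_natl opxM; congr (_ * _).
  have [sj|sj] := boolP (in_corner s j); last first.
    rewrite der_pf_corner_out // linear0 !mulr0 addr0 mul0r addr0.
    by have [e|_] := eqVneq j p; rewrite ?mul0r //; rewrite e sp in sj.
  have e1 : (j == p)%:R * der j q A = (j == p)%:R * B.
    by have [->|_] := eqVneq j p; rewrite ?mul0r.
  have e2 : (j == q)%:R * der j p A = - ((j == q)%:R * B).
    by have [->|_] := eqVneq j q; rewrite ?mul0r ?oppr0 // derC mulrN.
  rewrite X0 // opx_der opx_pf_corner // eqxx !mul1r der_natl -/A -/B e1 e2.
  transitivity (n%:R * A ^+ n * ((j == p)%:R * der j q A)
    + A ^+ n * ((j == p)%:R * B - (B - (j == q)%:R * B))); first by ring.
  by rewrite e1; ring.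
have cnt : \sum_j ((in_corner s j)%:R * (((j == p)%:R + (j == q)%:R - 1) * (A ^+ n * B)))
    = (2 - s.*2%:R) * (A ^+ n * B).
  under eq_bigr => j _ do rewrite mulrA.
  rewrite -mulr_suml; congr (_ * _).
  under eq_bigr => j _ do rewrite mulrBr mulrDr mulr1.
  rewrite sumrB big_split /= -natr_sum /in_corner sum_geq_nat.
  have in1 (r : 'I_l) : in_corner s r ->
      \sum_(j < l) ((l - s.*2 <= j)%N%:R * (j == r)%:R) = 1 :> P.
    move=> sr; rewrite (bigD1 r) //= eqxx mulr1 [(_ <= _)%N]sr big1 ?addr0 //.
    by move=> j /negPf ->; rewrite mulr0.
  by rewrite !in1 // subKn //; lia.
rewrite /opD; under eq_bigr => j _ do rewrite term.
rewrite -mulr_sumr big_split /= cnt -mulr_suml.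
have -> : \sum_j (j == p)%:R = 1 :> P.
  by rewrite (bigD1 p) //= eqxx big1 ?addr0 // => j /negPf ->.
rewrite derXn -/B mul1r -!mul_mpolyC -muln2 natrM /crit_exp.
rewrite !(mpolyCM, mpolyCB, mpolyCD, mpolyC1, mpolyC_nat).
by ring.
Qed.

Lemma opD_killed C p q f :
  (forall m, der p m f = 0) -> (forall m, der q m f = 0) -> opD C p q f = 0.
Proof.
move=> fp fq; rewrite /opD fp scaler0 subr0 big1 // => k _.
by rewrite derC fq oppr0 linear0.
Qed.

(** A factor F = P_r^c killed by [opD] enters only through the cross terms, each
    equal to c F d_pq: the effect is to replace C by C - c.  The factor g,
    free of the two indices, is inert. *)
Lemma opD_step C r c s k g p q :
  (s < r <= l./2)%N -> (c = 0%N \/ c%:R = crit_exp C r) ->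
  p = (l - s.+1.*2)%N :> nat -> q = p.+1 :> nat ->
  (forall m, der p m g = 0) -> (forall m, der q m g = 0) ->
  opD C p q (pf_corner r ^+ c * (g * pf_corner s.+1 ^+ k.+1)) =
  (k.+1%:R * (k.+1%:R - crit_exp C s.+1 + 2 * c%:R)) *:
     (pf_corner r ^+ c * (g * (pf_corner s.+1 ^+ k * pf_corner s))).
Proof.
move=> /andP[sr rl] cC pE qE gp gq.
have sl : (s.+1 <= l./2)%N by lia.
have sp : in_corner s.+1 p by rewrite /in_corner pE.
have sq : in_corner s.+1 q by rewrite /in_corner qE pE.
have sub i : in_corner s.+1 i -> in_corner r i by rewrite /in_corner; lia.
have [rp rq] := (sub p sp, sub q sq).
set F := pf_corner r ^+ c; set H := g * _.
have DF : opD C p q F = 0.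
  rewrite /F; case: c cC {F} => [_|c [//|cE]].
    by apply: opD_killed => m; rewrite expr0 der1.
  by rewrite opD_pf_corner_exp // cE subrr mulr0 scale0r.
have XF i j : in_corner r i -> in_corner r j -> opx i j F = (i == j)%:R * (c%:R * F).
  move=> ri rj; rewrite /F; case: (c) => [|n]; first by rewrite expr0 opx1 mul0r mulr0.
  by rewrite opxXn opx_pf_corner // exprSr; ring.
have Hout k' j : (j = p \/ j = q) -> ~~ in_corner s.+1 k' -> der k' j H = 0.
  move=> jpq sk; rewrite /H derM der_exp0 ?der_pf_corner_out // mulr0 addr0 derC.
  by case: jpq => ->; rewrite ?gp ?gq oppr0 mul0r.
have QE i j : (i = p \/ i = q) -> (j = p \/ j = q) ->
    opQ i j F H = c%:R * F * der i j H.
  move=> ipq jpq; rewrite /opQ (bigD1 i) //= XF ?eqxx ?mul1r; last 2 first.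
  - by case: ipq => ->.
  - by case: ipq => ->.
  rewrite big1 ?addr0 // => k' /negPf ki.
  have [sk|sk] := boolP (in_corner s.+1 k'); last by rewrite Hout // mulr0.
  rewrite XF ?ki ?mul0r //; first exact: sub.
  by case: ipq => ->.
have DH : opD C p q H = g * opD C p q (pf_corner s.+1 ^+ k.+1).
  rewrite /H opDM opD_killed // mul0r add0r !opQE !big1 ?subr0 ?addr0 //.
    by move=> m _; rewrite gq mul0r.
  by move=> m _; rewrite gp mul0r.
have dH : der p q H = k.+1%:R * (g * (pf_corner s.+1 ^+ k * pf_corner s)).
  by rewrite /H derM gp mul0r add0r derXn (der_pf_corner_top K sl pE qE); ring.
rewrite opDM DF mul0r add0r !QE ?[der q p H]derC ?DH ?dH; try by [left|right].
rewrite opD_pf_corner_exp // (der_pf_corner_top K sl pE qE) -!mul_mpolyC /crit_exp.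
rewrite !(mpolyCM, mpolyCB, mpolyCD, mpolyC1, mpolyC_nat).
by ring.
Qed.

(** The combinatorics of the descent, for any predicate N closed under the
    single steps.  The bound on the exponent in the hypothesis is the total
    exponent which has accumulated when level s + 1 is reached. *)
Lemma descend N F u t a e : (u <= t)%N ->
  (forall s k e', (u <= s < t)%N -> (k.+1 <= \sum_(s.+1 <= i < t.+1) a i + e)%N ->
     N (F * (pf_mon s a * pf_corner s ^+ e' * pf_corner s.+1 ^+ k.+1)) ->
     N (F * (pf_mon s a * pf_corner s ^+ e' * (pf_corner s.+1 ^+ k * pf_corner s)))) ->
  N (F * (pf_mon t a * pf_corner t ^+ e)) ->
  N (F * (pf_mon u a * pf_corner u ^+ (\sum_(u.+1 <= i < t.+1) a i + e))).
Proof.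
move=> ut; rewrite -(subnK ut); move: (t - u)%N => n {t ut}.
elim: n e => [|n IHn] e step Nf; first by rewrite add0n big_geq.
have sumS v : (v <= n + u)%N -> (\sum_(v.+1 <= i < (n + u).+2) a i =
    \sum_(v.+1 <= i < (n + u).+1) a i + a (n + u).+1)%N.
  by move=> vn; rewrite big_nat_recr.
rewrite addSn sumS ?leq_addl // -addnA; apply: IHn.
  move=> s k e' hs ke; apply: step; first by lia.
  by rewrite addSn sumS; lia.
move: Nf; rewrite addSn pf_monS -mulrA -exprD.
set T := (n + u)%N; have [] := (leqnn T, leqnn (a T.+1 + e)).
have inner k e' : (k <= a T.+1 + e)%N ->
    N (F * (pf_mon T a * pf_corner T ^+ e' * pf_corner T.+1 ^+ k)) ->
    N (F * (pf_mon T a * pf_corner T ^+ (e' + k))).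
  elim: k e' => [|k IHk] e' ke; first by rewrite expr0 mulr1 addn0.
  have h1 : (u <= T < n.+1 + u)%N by rewrite /T; lia.
  have h2 : (k.+1 <= \sum_(T.+1 <= i < (n.+1 + u).+1) a i + e)%N by rewrite addSn big_nat1.
  move=> /(step T k e' h1 h2) h; rewrite -addSnnS; apply: IHk; first by lia.
  by move: h; rewrite exprSr; congr N; ring.
by move=> _ _ h; apply: (inner _ 0%N) => //; rewrite expr0 mulr1.
Qed.
End Descent.

(** * Submodules and Pfaffian powers *)

Section Submodules.
Variables (K : numClosedFieldType) (l : nat).
Local Notation P := (poly_n K l).
Local Notation pf_corner := (pf_corner K l).
Local Notation pf_mon := (pf_mon K l).
Local Notation half := (l./2).
Implicit Types (f g h : P) (i j p q : 'I_l) (s t r : nat) (a b : nat -> nat)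
  (C : K) (N J : P -> Prop).

Definition tail a s : nat := (\sum_(s <= i < half.+1) a i)%N.

Lemma tailS a s : (s <= half)%N -> tail a s = (a s + tail a s.+1)%N.
Proof. by move=> sl; rewrite /tail big_ltn. Qed.

Lemma pf_mon_wt_tail a s i : (0 < s <= half)%N -> i = (l - s.*2)%N :> nat ->
  pf_mon_wt l half a i = (tail a s)%:Z.
Proof.
move=> /andP[s0 sl] iE; rewrite ffunE (big_cat_nat (n := s)) //=; last by lia.
rewrite big_nat_cond big1 ?add0n /tail.
  congr Posz; apply: eq_big_nat => s' hs; rewrite /in_corner iE.
  by rewrite (_ : (_ <= _)%N = true) ?mul1n //; lia.
move=> s' hs; rewrite /in_corner iE (_ : (_ <= _)%N = false) ?mul0n //; lia.
Qed.

(** The weight at index l - 2s is the sum of the exponents from s on, so the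
    weight determines the exponents. *)
Lemma pf_mon_wt_inj a b : pf_mon_wt l half a = pf_mon_wt l half b ->
  pf_mon half a = pf_mon half b.
Proof.
move=> e; have te s : (0 < s <= half.+1)%N -> tail a s = tail b s.
  move=> /andP[s0]; rewrite leq_eqVlt => /orP[/eqP ->|sl].
    by rewrite /tail !big_geq.
  have il : (l - s.*2 < l)%N by lia.
  have hs : (0 < s <= half)%N by rewrite s0.
  have /(congr1 (fun v : {ffun 'I_l -> int} => v (Ordinal il))) := e.
  by rewrite !(pf_mon_wt_tail _ hs) // => -[].
apply: eq_pf_mon => s /andP[s0 sl].
have := te s.+1 sl; have := te s; rewrite s0 (leq_trans sl) // => /(_ isT).
by rewrite (tailS a sl) (tailS b sl) => + e1; rewrite e1 => /addIn.
Qed.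

Lemma top_pair s : (s.+1 <= half)%N -> exists p q,
  p = (l - s.+1.*2)%N :> nat /\ q = p.+1 :> nat.
Proof.
move=> sl; have pl : (l - s.+1.*2 < l)%N by lia.
have ql : ((l - s.+1.*2).+1 < l)%N by lia.
by exists (Ordinal pl), (Ordinal ql).
Qed.

Lemma der_below s a e p q m : (s.+1 <= half)%N ->
  p = (l - s.+1.*2)%N :> nat -> q = p.+1 :> nat ->
  der p m (pf_mon s a * pf_corner s ^+ e) = 0 /\ der q m (pf_mon s a * pf_corner s ^+ e) = 0.
Proof.
move=> sl pE qE; have sl' : (s <= half)%N by lia.
have sp : ~~ in_corner s p by rewrite /in_corner pE; lia.
have sq : ~~ in_corner s q by rewrite /in_corner qE pE; lia.
by rewrite !derM !der_pf_mon_out // !der_exp0 ?der_pf_corner_out // !mulr0 !mul0r !addr0.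
Qed.

Lemma pf_corner_neq0 s : (s <= half)%N -> pf_corner s != 0.
Proof.
move=> sl; apply/eqP => e; have /eqP := sympl_pf_corner K sl.
by rewrite e meval0 eq_sym oner_eq0.
Qed.

Lemma pf_mon_single r a : (0 < r)%N -> (forall s, (s < r)%N -> a s = 0%N) ->
  pf_mon r a = pf_corner r ^+ a r.
Proof.
case: r => // r _ h; rewrite pf_monS (pf_mon_widen K l (u := 0)) ?pf_mon0 ?mul1r //.
by move=> s hs; apply: h; lia.
Qed.

(** The projection of the monomial on J is a highest weight vector of the same
    weight, hence a multiple of it: the monomial is in J or orthogonal to J.  In
    the second case so are its derivatives, and the descent by derivatives (no
    coefficient vanishes there) reaches a power of P_r that is in J. *)
Lemma ideal_pf_mon J r k a : gl_stable J -> ideal J -> (0 < r <= half)%N ->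
  J (pf_corner r ^+ k) -> (k <= tail a r)%N -> J (pf_mon half a).
Proof.
move=> gJ iJ /andP[r0 rl] Jr ka; have [sJ JX] := gJ.
pose a1 s := if (s < r)%N then a s else 0%N.
pose a2 s := if (s < r)%N then 0%N else a s.
have -> : pf_mon half a = pf_mon half a1 * pf_mon half a2.
  by rewrite -pf_monD; apply: eq_pf_mon => s _; rewrite /a1 /a2; case: ifP; lia.
apply: (iJ); set h := pf_mon half a2.
have hw : has_weight (pf_mon_wt l half a2) h by apply: weight_pf_mon.
have hh : highest h by apply: highest_pf_mon.
have [u [Ju uw uo]] := proj_weight gJ hw.
have [gO OX] := orth_gl_stable gJ.
have hu : highest u.
  move=> i j ji; apply: (orth_self (J := J)); first exact: JX.
  have -> : opx i j u = - opx i j (h - u) by rewrite linearB /= hh // sub0r opprK.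
  by apply: (subspaceN gO); apply: OX.
have [u0|u0] := eqVneq u 0; last first.
  have [b [c [c0 ub]]] := highest_class u0 uw hu.
  have bw : has_weight (pf_mon_wt l half b) u.
    by rewrite ub; apply: (subspaceZ (has_weight_subspace _ _)); apply: weight_pf_mon.
  rewrite /h (pf_mon_wt_inj (has_weight_inj u0 uw bw)).
  by apply: (subspace_unscale sJ c0); rewrite -ub.
move: uo; rewrite u0 subr0 => ho.
have := @descend K l (orth J) 1 r half a2 0 rl; rewrite expr0 mulr1 !mul1r => /(_ _ ho) H.
have {}H : orth J (pf_corner r ^+ tail a r).
  move: H; rewrite addn0 (_ : pf_mon r a2 = pf_corner r ^+ a r); last first.
    by rewrite pf_mon_single // /a2 ?ltnn // => s hs; rewrite ifT.
  rewrite -exprD tailS // /tail.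
  rewrite (_ : \sum_(r.+1 <= i < half.+1) a2 i = \sum_(r.+1 <= i < half.+1) a i)%N; last first.
    by apply: eq_big_nat => s hs; rewrite /a2 ifF //; lia.
  apply => s k' e' /andP[rs sh] _; rewrite !mul1r => ho'.
  have [p [q [pE qE]]] := top_pair sh.
  have [gp gq] := (fun m => (der_below a2 e' m sh pE qE).1,
    fun m => (der_below a2 e' m sh pE qE).2).
  have := orth_der p q iJ ho'; rewrite derM gp mul0r add0r derXn (der_pf_corner_top K sh pE qE).
  have -> : forall A B : P, A * (k'.+1%:R * B) = k'.+1%:R *: (A * B).
    by move=> A B; rewrite mulrCA mulr_natl scaler_nat.
  by apply: subspace_unscale => //; rewrite pnatr_eq0.
have Jt : J (pf_corner r ^+ tail a r) by rewrite -(subnK ka) exprD; apply: iJ.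
by have /eqP := orth_self Jt H; rewrite expf_eq0 (negPf (pf_corner_neq0 rl)) andbF.
Qed.

Lemma crit_expD C s n : crit_exp C (s + n) = crit_exp C s + n.*2%:R.
Proof. by rewrite /crit_exp natrD -muln2 natrM; ring. Qed.

Lemma stable_descend C N r c u a t e : stable C N ->
  (u <= t <= r)%N -> (r <= half)%N -> (c = 0%N \/ c%:R = crit_exp C r) ->
  (forall s k, (u < s <= t)%N -> (0 < k <= \sum_(s <= i < t.+1) a i + e)%N ->
     k%:R + 2 * c%:R != crit_exp C s) ->
  N (pf_corner r ^+ c * (pf_mon t a * pf_corner t ^+ e)) ->
  N (pf_corner r ^+ c * (pf_mon u a * pf_corner u ^+ (\sum_(u.+1 <= i < t.+1) a i + e))).
Proof.
move=> [[sN NX] iN ND] /andP[ut tr] rl cC ne; apply: descend => // s k e' hs ke Ns.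
have sl : (s.+1 <= half)%N by lia.
have [p [q [pE qE]]] := top_pair sl.
have [gp gq] := (fun m => (der_below a e' m sl pE qE).1,
  fun m => (der_below a e' m sl pE qE).2).
have sr : (s < r <= half)%N by lia.
have := ND p q _ Ns; rewrite (opD_step k sr cC pE qE gp gq).
apply: subspace_unscale => //; rewrite mulf_neq0 ?pnatr_eq0 //.
have := ne s.+1 k.+1 _ _; rewrite addrAC subr_eq0; apply; first by lia.
by rewrite ke.
Qed.

(** u is the last level at which the accumulated exponent meets the critical
    one.  Above it the plain descent works; below it the descent is carried out
    on multiples of P_u^c, where the exponent k would be critical for s only if
    k + 2c were equal to the critical exponent of s, which is at most c. *)
Lemma stable_pf_corner_exp C N a : stable C N -> N (pf_mon half a) ->
  N 1 \/ exists u c, [/\ (0 < u <= half)%N, (0 < c <= tail a u)%N,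
                        c%:R = crit_exp C u & N (pf_corner u ^+ c)].
Proof.
move=> stN Na; have [[sN NX] iN ND] := stN.
pose critical u := exists2 c, (0 < c <= tail a u)%N & c%:R = crit_exp C u.
have last_critical n : (n <= half)%N ->
    (forall s, (half - n < s <= half)%N -> ~ critical s) \/
    exists u, [/\ (half - n < u <= half)%N, critical u &
                  forall s, (u < s <= half)%N -> ~ critical s].
  elim: n => [|n IHn] nl; first by left => s; lia.
  have [h|[u [hu bu ub]]] := IHn (ltnW nl); last by right; exists u; split=> //; lia.
  have [b|nb] := EM (critical (half - n)%N).
    by right; exists (half - n)%N; split=> //; lia.
  left=> s hs; have [->//|ns] := eqVneq s (half - n)%N; apply: h; lia.
have N0 u : (u <= half)%N -> (forall s, (u < s <= half)%N -> ~ critical s) ->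
    N (pf_mon u a * pf_corner u ^+ (tail a u.+1)).
  move=> ul nb; have := @stable_descend C N half 0 u a half 0 stN.
  rewrite expr0 !mul1r mulr1 !addn0; apply; rewrite ?ul ?leqnn //; first by left.
  move=> s k hs; rewrite mulr0 addr0 addn0 => hk; apply/eqP => e.
  by apply: (nb s hs); exists k.
have [nb|[u [hu [c hc cE] nb]]] := last_critical half (leqnn _).
  left; have := N0 0%N (leq0n _); rewrite pf_mon0 pf_corner0 expr1n mulr1; apply => s hs.
  by apply: nb; rewrite subnn.
right; exists u, c; split=> //; first by lia.
have ul : (u <= half)%N by lia.
have := @stable_descend C N u c 0 a u (tail a u.+1) stN.
rewrite pf_mon0 pf_corner0 expr1n !mulr1; apply => //; first by rewrite leqnn.
- by right.
- move=> s k hs hk; have su : u = (s + (u - s))%N by lia.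
  move: (cE); rewrite [X in crit_exp C X]su crit_expD => {}cE.
  have -> : crit_exp C s = c%:R - (u - s).*2%:R by rewrite cE addrK.
  apply/eqP => e.
  have /eqP : (k + c + (u - s).*2)%:R = 0 :> K.
    transitivity ((k%:R + 2 * c%:R) - (c%:R - (u - s).*2%:R) : K).
      by rewrite !natrD; ring.
    by rewrite e subrr.
  by rewrite pnatr_eq0; lia.
- by apply: iN; apply: N0 => // s hs; apply: nb.
Qed.

Section TopSubmodule.
Variables (C : K) (c : nat).
Hypothesis cE : c.+1%:R = crit_exp C half.

(** The gl_l-module generated by the critical power of the largest Pfaffian. *)
Inductive gl_span : P -> Prop :=
 | gl_span_gen : gl_span (pf_corner half ^+ c.+1)
 | gl_span_lin (k : K) f g : gl_span f -> gl_span g -> gl_span (k *: f + g)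
 | gl_span_opx i j f : gl_span f -> gl_span (opx i j f).

Inductive ideal_span : P -> Prop :=
 | ideal_span_gen f : gl_span f -> ideal_span f
 | ideal_span_lin (k : K) f g : ideal_span f -> ideal_span g -> ideal_span (k *: f + g)
 | ideal_span_mul i j f : ideal_span f -> ideal_span (varY K i j * f).

Lemma gl_span_stable : gl_stable gl_span.
Proof.
split; last exact: gl_span_opx.
split; last exact: gl_span_lin.
have g := gl_span_gen; have := gl_span_lin (-1) g g.
by rewrite scaleN1r addNr.
Qed.

Lemma ideal_span_subspace : subspace ideal_span.
Proof.
split; last exact: ideal_span_lin.
by apply: ideal_span_gen; case: gl_span_stable => -[].
Qed.

Hypothesis half0 : (0 < half)%N.

(** On the generator, the exponent is critical if p and q are both in the corner;
    otherwise (l is odd) one of the indices does not occur in it.  The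
    commutation relation with [opx] propagates this to the span. *)
Lemma gl_span_opD p q f : gl_span f -> opD C p q f = 0.
Proof.
move=> Wf; elim: Wf p q => {f} [p q|k f g _ Df _ Dg p q|i j f _ Df p q]; last 2 first.
- by rewrite linearP /= Df Dg scaler0 addr0.
- by have := opx_opD C i j p q f; rewrite !Df linear0 !mulr0 addr0 subr0.
have [pc|pc] := boolP (in_corner half p); last first.
  have dp m : der p m (pf_corner half ^+ c.+1) = 0 by rewrite der_exp0 ?der_pf_corner_out.
  rewrite /opD dp scaler0 subr0 big1 // => k _; rewrite opx_out // => m.
  by rewrite der_comm dp linear0.
have [qc|qc] := boolP (in_corner half q); last first.
  have dq m : der m q (pf_corner half ^+ c.+1) = 0.
    by rewrite derC der_exp0 ?der_pf_corner_out ?oppr0.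
  by rewrite /opD dq scaler0 subr0 big1 // => k _; rewrite dq linear0.
by rewrite opD_pf_corner_exp // cE subrr mulr0 scale0r.
Qed.

Lemma ideal_span_stable : stable C ideal_span.
Proof.
have sJ := ideal_span_subspace.
have iJ : ideal ideal_span by apply: ideal_gen => //; apply: ideal_span_mul.
have XJ i j f : ideal_span f -> ideal_span (opx i j f).
  elim=> {f} [f Wf|k f g _ Xf _ Xg|p q f Jf Xf].
  - exact/ideal_span_gen/gl_span_opx.
  - by rewrite linearP; apply: ideal_span_lin.
  - by rewrite opxM; apply: subspaceD => //; apply: iJ.
split=> // i j f; elim=> {f} [f Wf|k f g _ Df _ Dg|p q f Jf Df].
- by rewrite gl_span_opD //; apply: subspace0.
- by rewrite linearP; apply: ideal_span_lin.
- rewrite opDM !opQE; apply: subspaceB => //; first apply: subspaceD => //.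
  + by apply: subspaceD => //; apply: iJ.
  + by apply: subspace_sum => // m _; apply/iJ/XJ.
  + by apply: subspace_sum => // m _; apply/iJ/XJ.
Qed.

Lemma varY_at0 i j : (varY K i j).@[fun=> 0] = 0.
Proof.
case: (pairP i j) => [h|h|<-].
- by rewrite (varY_lt K h) mevalXU.
- by rewrite varYC mevalN (varY_lt K h) mevalXU oppr0.
- by rewrite varYY meval0.
Qed.

Lemma opx_at0 i j f : (opx i j f).@[fun=> 0] = 0.
Proof.
by rewrite opxE raddf_sum /= big1 // => m _; rewrite mevalM varY_at0 mul0r.
Qed.

(** An [opx] always vanishes at the origin, and the Pfaffian is its own image
    under a diagonal one: so the ideal does not contain 1. *)
Lemma ideal_span_at0 f : ideal_span f -> f.@[fun=> 0] = 0.
Proof.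
have lin k g h : g.@[fun=> 0] = 0 -> h.@[fun=> 0] = 0 -> (k *: g + h).@[fun=> 0] = 0.
  by move=> g0 h0; rewrite mevalD mevalZ g0 h0 mulr0 addr0.
elim=> {f} [f|k f g _ f0 _ g0|p q f _ _]; [|exact: lin|by rewrite mevalM varY_at0 mul0r].
elim=> {f} [|k f g _ f0 _ g0|i j f _ _]; [|exact: lin|exact: opx_at0].
have il : (l - half.*2 < l)%N by lia.
have := @opx_pf_corner K _ _ (Ordinal il) (Ordinal il) (leqnn half) (leqnn _) (leqnn _).
rewrite eqxx mul1r => <-.
by rewrite exprS mevalM opx_at0 mul0r.
Qed.
End TopSubmodule.

Lemma latticeP s C : in_half_lattice (- s%:R + 1 / 2%:R) C <->
  exists2 c, (0 < c)%N & c%:R = crit_exp C s.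
Proof.
split=> -[c c0 e]; exists c => //.
  by rewrite /crit_exp e; field.
by rewrite e /crit_exp; field.
Qed.

Variable Psi : P.
Hypothesis l2 : (2 <= l)%N.

Lemma nonzero_highest N : gl_stable N -> ~ (forall f, N f -> f = 0) ->
  exists a, N (pf_mon half a).
Proof.
move=> gN /existsNP [f /not_implyP [Nf /eqP f0]].
have [g [w [Ng g0 gw hg]]] := exists_highest gN Nf f0.
have [a [c [c0 gE]]] := highest_class g0 gw hg.
by exists a; apply: (subspace_unscale gN.1 c0); rewrite -gE.
Qed.

Lemma simpleP C : simple_module C Psi <-> ~ in_half_lattice (- half%:R + 1 / 2%:R) C.
Proof.
have h0 : (0 < half)%N by lia.
split=> [[_ simp] /latticeP [[//|c] _ cE]|nl].
  have := simp (ideal_span c) ((submoduleP _ _ l2 _).2 (ideal_span_stable cE)).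
  case=> h.
    have := h _ (ideal_span_gen (gl_span_gen c)) => /eqP.
    by rewrite expf_eq0 (negPf (pf_corner_neq0 (leqnn _))).
  by have := ideal_span_at0 h0 (h 1); rewrite meval1 => /eqP; rewrite oner_eq0.
split; first by exists 1; apply/eqP; rewrite oner_eq0.
move=> N /(submoduleP _ _ l2) stN; have [[sN NX] iN ND] := stN.
have [z|nz] := EM (forall f, N f -> f = 0); [by left|right=> f].
have [a Na] := nonzero_highest (conj sN NX) nz.
have [N1|[u [c [hu hc cE _]]]] := stable_pf_corner_exp stN Na.
  by rewrite -(mulr1 f); apply: iN.
case: nl; apply/latticeP; exists (c + (half - u).*2)%N; first by lia.
by rewrite natrD cE -crit_expD subnKC //; lia.
Qed.

(** A submodule N' containing the powers that N contains also contains N: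
    otherwise a monomial in the Pfaffians separates them, but the descent from it
    finds such a power, whose ideal contains the monomial. *)
Lemma proper_generated C (n : nat) (N : P -> Prop) :
  (forall m, (0 < m)%N -> (m < n)%N -> ~ in_half_lattice (- m%:R + 1 / 2%:R) C) ->
  is_submodule C Psi N -> proper_submod N ->
  exists I : {set 'I_half.+1},
    (forall r : 'I_half.+1, r \in I -> (n <= r)%N) /\
    (forall f, N f <-> generated_submod C Psi (pfaff_powers C I) f).
Proof.
move=> least subspaceN [f0 nf0]; have /(submoduleP _ _ l2) stN := subspaceN.
have [[sN NX] iN ND] := stN.
pose I := [set r : 'I_half.+1 | (n <= r)%N &&
  `[< exists2 k : nat, k%:R = crit_exp C r & N (pfaffP K r ^+ k) >]].
exists I; split=> [r|f]; first by rewrite inE => /andP[].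
split=> [Nf N' subN' gen|]; last first.
  apply => // g [r [k [rI kE ->]]]; move: rI; rewrite inE => /andP[_ /asboolP [k' k'E]].
  suff -> : k = k' by [].
  by apply/eqP; rewrite -(eqr_nat K) kE k'E.
have /(submoduleP _ _ l2) stN' := subN'; have [[sN' NX'] iN' ND'] := stN'.
apply: contrapT => nN'f.
have [|g [w [Ng nN'g gw hg]]] := gl_complement_highest (conj sN NX) (conj sN' NX').
  by move=> h; apply/nN'f/h.
have [g0|g0] := eqVneq g 0; first by apply: nN'g; rewrite g0; apply: subspace0.
have [a [c [c0 gE]]] := highest_class g0 gw hg.
have Na : N (pf_mon half a) by apply: (subspace_unscale sN c0); rewrite -gE.
have [N1|[u [k [hu hk kE Nk]]]] := stable_pf_corner_exp stN Na.
  by apply: nf0; rewrite -(mulr1 f0); apply: iN.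
apply: nN'g; rewrite gE; apply: subspaceZ => //.
have uP : (inord u : 'I_half.+1) = u :> nat by rewrite inordK //; lia.
apply: (ideal_pf_mon (conj sN' NX') iN' hu (k := k)); last by lia.
apply: gen; exists (inord u), k; split=> //; last by rewrite uP.
rewrite inE uP; apply/andP; split; last by apply/asboolP; exists k.
rewrite leqNgt; apply/negP => un; apply: (least u) => //; first by lia.
by apply/latticeP; exists k => //; lia.
Qed.
End Submodules.

Theorem theorem4p8 (R : realType) (l : nat) (C : R[i]) (Psi : poly_n R[i] l)
    (hl : (2 <= l)%N) :
  (simple_module C Psi <->
     ~ in_half_lattice (- (l./2)%:R + 1 / 2%:R) C) /\
  (forall n : nat, (0 < n)%N -> (n <= l./2)%N ->
     in_half_lattice (- n%:R + 1 / 2%:R) C ->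
     (* n is the least such positive integer *)
     (forall m : nat, (0 < m)%N -> (m < n)%N ->
        ~ in_half_lattice (- m%:R + 1 / 2%:R) C) ->
     forall N : poly_n R[i] l -> Prop,
       is_submodule C Psi N -> proper_submod N ->
       exists I : {set 'I_(l./2).+1},
         (forall r, r \in I -> (n <= r)%N) /\
         (forall f, N f <-> generated_submod C Psi (pfaff_powers C I) f)).
Proof.
split; first exact: (@simpleP R[i] l Psi hl C).
move=> n _ _ _ least N; exact: (@proper_generated R[i] l Psi hl C n N least).
Qed.
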